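(* For each $d\ge 9$ and each $\mu\in(0,1]$ there exists $\beta^*=\beta^*(\mu,d)\in(0,1)$ such that for every $\beta\in[0,1]$ with $\beta>\beta^*$, the ERWD $(\omega_n)_{n\ge0}$ on $\mathbb{Z}^d$ with parameters $\beta,\mu$ satisfies $$\mathbb{Q}\Big(\lim_{n\to\infty}\frac{\omega_n^{[1]}}{n}>0\Big)=1.$$
   Context: Let $e_1=(1,0,\dots,0)\in\mathbb{Z}^d$, and let $x^{[1]}$ denote the first component of $x\in\mathbb{Z}^d$. For $\beta,\mu\in[0,1]$, the ERWD (excited random walk with opposing drift) on $\mathbb{Z}^d$ with parameters $\beta,\mu$ is the nearest-neighbour random process $(\omega_n)_{n\ge 0}$ with $\omega_0=0$ and law $\mathbb{Q}=\mathbb{Q}_{d,\beta,\mu}$ determined by the following: given the history $\omega_0=\eta_0,\dots,\omega_i=\eta_i$, the conditional probability of stepping to $\eta_i+x$, for each unit vector $x$ (nearest neighbour of the origin), is $$\frac{1+(e_1\cdot x)\,\beta}{2d}\ \text{ if }\eta_i\notin\{\eta_0,\dots,\eta_{i-1}\},\qquad \frac{1-(e_1\cdot x)\,\mu}{2d}\ \text{ if }\eta_i\in\{\eta_0,\dots,\eta_{i-1}\}.$$ In particular the first step has probabilities $(2d)^{-1}(1+\beta\, e_1\cdot x)$. It is known (ergodic argument of Bolthausen, Sznitman and Zeitouni) that for every $d\ge 6$ and $(\beta,\mu)\in[0,1]^2$ there is a deterministic vector $v=v(d,\mu,\beta)$ with $\mathbb{Q}(\lim_{n\to\infty}n^{-1}\omega_n=v)=1$.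 *)

(* Defs.v *)
From HB Require Import structures.
From mathcomp Require Import all_boot all_order all_algebra.
From mathcomp Require Import all_classical all_reals all_analysis.
Set Implicit Arguments.
Unset Strict Implicit.
Unset Printing Implicit Defensive.
Import Order.TTheory GRing.Theory Num.Theory.
Import numFieldNormedType.Exports.
Local Open Scope classical_set_scope.
Local Open Scope ring_scope.

Definition dot (d : nat) (x y : 'rV[int]_d) : int := \sum_(j < d) x 0 j * y 0 j.

(* The matrix index j ranges over 'I_d, so the first coordinate is j = 0. *)
Definition e1 (d : nat) : 'rV[int]_d := \row_(j < d) (nat_of_ord j == 0%N)%:Z.

(* x^[1]; the value for d = 0 is junk. *)
Definition coord1 (d : nat) : 'rV[int]_d -> int :=
  match d return 'rV[int]_d -> int with
  | 0%N => fun=> 0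
  | d'.+1 => fun x => x 0 ord0
  end.

Lemma dot_e1 (d : nat) (x : 'rV[int]_d) : dot (e1 d) x = coord1 x.
Proof.
case: d x => [|d] x; rewrite /dot ?big_ord0// big_ord_recl mxE eqxx mul1r.
by rewrite big1 ?addr0// => i _; rewrite mxE mul0r.
Qed.

Definition unit_vector (d : nat) (x : 'rV[int]_d) : bool := dot x x == 1.

Definition visited_before (d : nat) (eta : nat -> 'rV[int]_d) (i : nat) : bool :=
  [exists k : 'I_i, eta k == eta i].

(* Probability of stepping from eta i to eta i + x given the history
   eta 0, ..., eta i (later values of eta are irrelevant). *)
Definition step_prob (R : realType) (d : nat) (beta mu : R)
    (eta : nat -> 'rV[int]_d) (i : nat) (x : 'rV[int]_d) : R :=
  if unit_vector x then
    if visited_before eta i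
    then (1 - (dot (e1 d) x)%:~R * mu) / (2 * d)%:R
    else (1 + (dot (e1 d) x)%:~R * beta) / (2 * d)%:R
  else 0.

Definition cond_prob (R : realType) (disp : measure_display)
    (T : measurableType disp) (P : probability T R) (B A : set T) : R :=
  fine (P (A `&` B)) / fine (P A).

Definition history (d : nat) (T : Type) (omega : nat -> T -> 'rV[int]_d)
    (eta : nat -> 'rV[int]_d) (i : nat) : set T :=
  [set t | forall k : nat, (k <= i)%N -> omega k t = eta k].

(* omega has the law Q_{d,beta,mu}. As Z^d is countable and carries the discrete
   sigma-algebra, measurability of omega n only concerns fibers of points. *)
Record is_ERWD (R : realType) (d : nat) (beta mu : R) (disp : measure_display)
    (T : measurableType disp) (P : probability T R)
    (omega : nat -> T -> 'rV[int]_d) : Prop := IsERWD {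
  ERWD_measurable : forall (n : nat) (x : 'rV[int]_d),
    measurable (omega n @^-1` [set x]);
  ERWD_start : P [set t | omega 0%N t = 0] = 1%E;
  ERWD_step : forall (eta : nat -> 'rV[int]_d) (i : nat) (x : 'rV[int]_d),
    P (history omega eta i) != 0%E ->
    cond_prob P [set t | omega i.+1 t = eta i + x] (history omega eta i)
      = step_prob beta mu eta i x
}.

(* Main.v *)
(** The projection of the walk orthogonally to e_1 is a lazy simple random walk
    in d - 1 >= 8 dimensions that does not depend on the history. If the walk is
    driven by i.i.d. letters, then at a cut time T of the projection (no
    projected site is visited both up to T and after T) the future displacement
    is that of a fresh walk driven by the remaining letters. Hence the
    displacement of a concatenation of words is the sum of the displacements up
    to an error controlled by the first cut time after each junction. The bound
    sup_x P(Y_k = x) = O(k^-3) makes long-range intersections summable, and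
    nearby intersections are avoided with positive probability in disjoint
    blocks, so long stretches without cut times are unlikely. This gives a
    variance estimate for the displacement and the Cauchy property of its
    normalized mean, hence the law of large numbers, by the Borel-Cantelli lemma
    along the times j^20 and interpolation.

    The mean drift per step is ((beta + mu) r - mu) / d, with r the proportion
    of new sites. The function 1 / (1 + 2 |x|^2) is superharmonic for the
    projected walk, which therefore returns with probability at most 11/27, so
    r >= 16/27 and the speed is positive as soon as beta > 11/16. *)

Require Import Defs.
From mathcomp Require Import all_boot all_order all_algebra.
From mathcomp Require Import all_classical all_reals all_analysis.
From mathcomp Require Import ring lra zify.
Set Implicit Arguments.
Unset Strict Implicit.
Unset Printing Implicit Defensive.
Import Order.TTheory GRing.Theory Num.Theory.
Import numFieldNormedType.Exports.
Local Open Scope ring_scope.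

(** * Expectations over words of independent letters *)

Lemma eq_ler {R : numDomainType} (x y : R) : x = y -> x <= y.
Proof. by move->. Qed.

Section WordExpectation.
Context {R : realFieldType} {A : finType} (p : A -> R).

(** Iterated finite sums stand in for a product measure, so that every estimate on words is finite
    algebra. *)
Fixpoint Ex (n : nat) (f : seq A -> R) : R :=
  if n is n'.+1 then \sum_a p a * Ex n' (fun w => f (a :: w)) else f [::].

Lemma ExS n f : Ex n.+1 f = \sum_a p a * Ex n (fun w => f (a :: w)).
Proof. by []. Qed.

Lemma eq_Ex n f g : (forall w, size w = n -> f w = g w) -> Ex n f = Ex n g.
Proof.
elim: n f g => [|n IHn] f g fg /=; first exact: fg.
by apply: eq_bigr => a _; congr (_ * _); apply: IHn => w sw; rewrite fg//= sw.
Qed.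

Lemma ExD n f g : Ex n (fun w => f w + g w) = Ex n f + Ex n g.
Proof.
elim: n f g => [//|n IHn] f g /=; rewrite -big_split/=.
by apply: eq_bigr => a _; rewrite IHn mulrDr.
Qed.

Lemma ExZ n c f : Ex n (fun w => c * f w) = c * Ex n f.
Proof.
elim: n f => [//|n IHn] f /=; rewrite mulr_sumr.
by apply: eq_bigr => a _; rewrite IHn mulrCA.
Qed.

Lemma ExZr n c f : Ex n (fun w => f w * c) = Ex n f * c.
Proof. by rewrite mulrC -ExZ; apply: eq_Ex => w _; rewrite mulrC. Qed.

Lemma ExB n f g : Ex n (fun w => f w - g w) = Ex n f - Ex n g.
Proof.
by rewrite -mulN1r -ExZ -ExD; apply: eq_Ex => w _; rewrite mulN1r.
Qed.

Lemma Ex0 n : Ex n (fun=> 0) = 0.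
Proof. by elim: n => [//|n IHn] /=; rewrite big1// => a _; rewrite IHn mulr0. Qed.

Lemma Ex_sum (I : Type) (r : seq I) (P : pred I) n (F : I -> seq A -> R) :
  Ex n (fun w => \sum_(i <- r | P i) F i w) = \sum_(i <- r | P i) Ex n (F i).
Proof.
elim: r => [|i r IHr].
  by rewrite big_nil -[RHS](Ex0 n); apply: eq_Ex => w _; rewrite big_nil.
rewrite big_cons -IHr; case: ifPn => Pi; last first.
  by apply: eq_Ex => w _; rewrite big_cons (negbTE Pi).
by rewrite -ExD; apply: eq_Ex => w _; rewrite big_cons Pi.
Qed.

Lemma Ex_cat m n f : Ex (m + n) f = Ex m (fun u => Ex n (fun v => f (u ++ v))).
Proof.
elim: m f => [//|m IHm] f; rewrite addSn /=.
by apply: eq_bigr => a _; rewrite IHm.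
Qed.

Lemma Ex_rcons n f :
  Ex n.+1 f = Ex n (fun u => \sum_a p a * f (rcons u a)).
Proof.
rewrite -addn1 Ex_cat; apply: eq_Ex => u _ /=.
by apply: eq_bigr => a _; rewrite cats1.
Qed.

Hypothesis p_ge0 : forall a, 0 <= p a.

Lemma le_Ex n f g : (forall w, size w = n -> f w <= g w) -> Ex n f <= Ex n g.
Proof.
elim: n f g => [|n IHn] f g fg /=; first exact: fg.
apply: ler_sum => a _; apply: ler_wpM2l => //.
by apply: IHn => w sw; apply: fg; rewrite /= sw.
Qed.

Lemma Ex_ge0 n f : (forall w, size w = n -> 0 <= f w) -> 0 <= Ex n f.
Proof. by move=> f0; rewrite -(Ex0 n); exact: le_Ex. Qed.

Hypothesis p_sum1 : \sum_a p a = 1.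

Lemma Ex_cst n c : Ex n (fun=> c) = c.
Proof. by elim: n => [//|n IHn] /=; rewrite -mulr_suml p_sum1 mul1r IHn. Qed.

Lemma Ex_le_cst n f c : (forall w, size w = n -> f w <= c) -> Ex n f <= c.
Proof. by move=> fc; rewrite -(Ex_cst n c); exact: le_Ex. Qed.

Lemma Ex_take m n f : Ex (m + n) (fun w => f (take m w)) = Ex m f.
Proof.
rewrite Ex_cat; apply: eq_Ex => u su; rewrite -[RHS](Ex_cst n).
by apply: eq_Ex => v _; rewrite take_size_cat.
Qed.

Lemma Ex_drop m n f : Ex (m + n) (fun w => f (drop m w)) = Ex n f.
Proof.
rewrite Ex_cat -[RHS](Ex_cst m); apply: eq_Ex => u su.
by apply: eq_Ex => v _; rewrite drop_size_cat.
Qed.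

Lemma Ex_infix N i k f : (i + k <= N)%N ->
  Ex N (fun w => f (take k (drop i w))) = Ex k f.
Proof.
move=> ikN; have -> : N = (i + (k + (N - (i + k))))%N by lia.
by rewrite (Ex_drop _ _ (fun w => f (take k w))) Ex_take.
Qed.

(** Nonnegativity of the variance of [f]. *)
Lemma Ex_sqr_le n f : Ex n f ^+ 2 <= Ex n (fun w => f w ^+ 2).
Proof.
have : 0 <= Ex n (fun w => (f w - Ex n f) ^+ 2).
  by apply: Ex_ge0 => w _; exact: sqr_ge0.
set e := Ex n f; rewrite (@eq_Ex _ _ (fun w => (f w ^+ 2 + (- (2 * e)) * f w) + e ^+ 2)).
  by rewrite !ExD ExZ Ex_cst -/e; nra.
by move=> w _; ring.
Qed.

Lemma Ex_markov n f (c b : R) (Q : pred (seq A)) : 0 < c ->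
    (forall w, size w = n -> 0 <= f w) ->
    (forall w, size w = n -> Q w -> c <= f w) -> Ex n f <= b ->
  Ex n (fun w => (Q w)%:R) <= b / c.
Proof.
move=> c0 f0 Qf fb; rewrite ler_pdivlMr// -ExZr; apply: le_trans fb.
apply: le_Ex => w sw; case: (boolP (Q w)) => [Qw|_]; first by rewrite mul1r Qf.
by rewrite mul0r f0.
Qed.

Lemma Ex_union (I : Type) (r : seq I) n (Q : I -> pred (seq A)) :
  Ex n (fun w => (has (Q^~ w) r)%:R) <= \sum_(i <- r) Ex n (fun w => (Q i w)%:R).
Proof.
rewrite -Ex_sum; apply: le_Ex => w _; elim: r => [|i r IHr] /=.
  by rewrite big_nil.
rewrite big_cons; case: (Q i w) => /=; last by rewrite add0r.
by rewrite lerDl sumr_ge0.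
Qed.

(** Disjoint blocks of letters are independent; the induction splits off the first block. *)
Lemma Ex_blocks (k K N : nat) (f : seq A -> R) : (K * k <= N)%N ->
  Ex N (fun w => \prod_(j < K) f (take k (drop (j * k) w))) = Ex k f ^+ K.
Proof.
elim: K N => [|K IHK] N KN.
  by rewrite expr0 -[RHS](Ex_cst N); apply: eq_Ex => w _; rewrite big_ord0.
have -> : N = (k + (N - k))%N by nia.
rewrite Ex_cat exprS -ExZr; apply: eq_Ex => u su.
rewrite -(IHK (N - k)%N); last nia.
rewrite -ExZ; apply: eq_Ex => v sv.
rewrite big_ord_recl/= mul0n drop0 take_size_cat//; congr (_ * _).
apply: eq_bigr => i _; congr (f (take k _)).
by rewrite drop_cat su /bump leq0n add1n mulSn ltnNge leq_addr/= addKn.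
Qed.

End WordExpectation.

(** * The heat kernel of the projected walk *)

Section CentralBinomial.

(** Binomials increase up to the middle ([incr]), and the symmetry [k -> n - k] covers the other
    half. *)
Lemma leq_bin_half n k : ('C(n, k) <= 'C(n, n./2))%N.
Proof.
have incr j i : (j + i <= n./2)%N -> ('C(n, j) <= 'C(n, j + i))%N.
  elim: i => [|i IHi] jin; first by rewrite addn0.
  apply: leq_trans (IHi _) _; first lia.
  rewrite addnS; have := mul_bin_left n (j + i).
  by nia.
have [kn|kn] := leqP k n; last by rewrite bin_small.
have [kh|kh] := leqP k n./2.
  by rewrite -(subnKC kh) incr// subnKC.
rewrite -(bin_sub kn); have h : (n - k <= n./2)%N by lia.
by rewrite -(subnKC h) incr// subnKC.
Qed.

(** Passing from [m] to [m + 1] multiplies the binomial by [2 (2m + 1) / (m + 1)], and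
    [4 (2m + 1) (2m + 3) <= 16 (m + 1)^2]. *)
Lemma central_bin_bound m : ('C(m.*2, m) ^ 2 * m.*2.+1 <= 16 ^ m)%N.
Proof.
elim: m => [//|m IHm].
have e : (m.+1 * 'C(m.+1.*2, m.+1) = 2 * m.*2.+1 * 'C(m.*2, m))%N.
  have h1 := mul_bin_diag m.+1.*2 m; have h2 := mul_bin_down m.*2.+1 m.
  rewrite (_ : m.*2.+1 - m = m.+1)%N in h2; last lia.
  rewrite -h1 doubleS /= in h2 *; nia.
have : (m.+1 ^ 2 * ('C(m.+1.*2, m.+1) ^ 2 * m.+1.*2.+1) <= m.+1 ^ 2 * 16 ^ m.+1)%N.
  have -> (a x b : nat) : (a ^ 2 * (x ^ 2 * b) = (a * x) ^ 2 * b)%N by ring.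
  rewrite e (expnS 16).
  move: IHm; set c := 'C(_, _); set P := (16 ^ m)%N => IHm.
  have -> : ((2 * m.*2.+1 * c) ^ 2 * m.+1.*2.+1 =
    (4 * m.*2.+1 * m.+1.*2.+1) * (c ^ 2 * m.*2.+1))%N by ring.
  apply: leq_trans (leq_mul (leqnn _) IHm) _.
  rewrite [in leqRHS]mulnA leq_mul2r; apply/orP; right; lia.
by rewrite leq_pmul2l// expn_gt0.
Qed.

Lemma bin_half_bound n : ('C(n, n./2) ^ 2 * n.+1 <= 2 * 4 ^ n)%N.
Proof.
rewrite -{1 3 4}(odd_double_half n); set m := n./2; case: (odd n) => /=.
  rewrite add1n (expnS 4).
  have le2 : ('C(m.*2.+1, m) <= 2 * 'C(m.*2, m))%N.
    case: (m) => [//|k]; rewrite binS.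
    by have := leq_bin_half k.+1.*2 k; rewrite doubleK; lia.
  have := central_bin_bound m; rewrite -[16%N]/(4 ^ 2)%N -expnM mul2n.
  move: le2; set c := 'C(m.*2, m); set a := 'C(_, m); set P := (4 ^ _)%N.
  move=> le2 h; have a2 : (a ^ 2 <= 4 * c ^ 2)%N by nia.
  apply: leq_trans (leq_mul a2 (leqnn _)) _.
  move: h; move: (c ^ 2)%N => x; move: P => P; nia.
rewrite add0n; have := central_bin_bound m.
by rewrite -[16%N]/(4 ^ 2)%N -expnM mul2n; lia.
Qed.

End CentralBinomial.

(** * One-dimensional simple random walk *)

Section SimpleWalk.
Context {R : realFieldType}.

Fixpoint srw (n : nat) (z : int) : R :=
  if n is n'.+1 then (srw n' (z - 1) + srw n' (z + 1)) / 2 else (z == 0)%:R.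

(** For [y = z + n] this counts the [n]-step paths from 0 to [z], which have [y / 2] upward steps;
    the shift turns parity and range into conditions on [y] alone. *)
Definition even_bin (n : nat) (y : int) : nat :=
  if y is Posz k then (~~ odd k * 'C(n, k./2))%N else 0%N.

Lemma even_binS n (y : int) :
  even_bin n.+1 y = (even_bin n y + even_bin n (y - 2))%N.
Proof.
case: y => [[|[|k]]|k]; rewrite /even_bin.
- by rewrite /= !bin0.
- by [].
- have -> : (Posz k.+2 - 2 = Posz k)%R by lia.
  rewrite [(k.+2)./2]/= binS /= negbK; case: (odd k) => //=; lia.
- have -> : (Negz k - 2 = Negz k.+2)%R by lia.
  by [].
Qed.

Lemma srwE n z : srw n z = (even_bin n (z + n%:Z))%:R / 2 ^+ n.
Proof.
elim: n z => [|n IHn] z.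
  rewrite /= addr0 expr0 divr1; case: z => [[|[|k]]|k] //=.
  by rewrite bin0n /=; case: odd.
rewrite /= !IHn even_binS natrD.
have -> : z + n.+1%:Z = z + 1 + n%:Z by lia.
have -> : z + 1 + n%:Z - 2 = z - 1 + n%:Z by lia.
by rewrite exprS; field; apply: expf_neq0; rewrite pnatr_eq0.
Qed.

Lemma srw_ge0 n z : 0 <= srw n z.
Proof. by rewrite srwE divr_ge0// ?ler0n// exprn_ge0. Qed.

Lemma srw_sqr n z : srw n z ^+ 2 <= 2 / n.+1%:R.
Proof.
have eb : (even_bin n (z + n%:Z) <= 'C(n, n./2))%N.
  case: (_ + _) => //= k; case: odd => //=; rewrite mul1n; exact: leq_bin_half.
have h : (even_bin n (z + n%:Z) ^ 2 * n.+1 <= 2 * 4 ^ n)%N.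
  by apply: leq_trans (bin_half_bound n); rewrite leq_mul2r leq_exp2r// eb orbT.
rewrite srwE expr_div_n -exprM mulnC exprM -(natrX _ 2 2).
rewrite ler_pdivlMr ?ltr0n// mulrAC ler_pdivrMr ?exprn_gt0 ?ltr0n//.
by rewrite -!natrX -!natrM ler_nat.
Qed.

(** The sixth power serves the six coordinates of the heat kernel bound; consecutive factors are the
    form in which size-biasing and telescoping work. *)
Lemma srw_pow6 n z :
  srw n z ^+ 6 <= 48 / (n.+1%:R * n.+2%:R * n.+3%:R).
Proof.
rewrite -[6%N]/(2 * 3)%N exprM.
apply: (@le_trans _ _ ((2 / n.+1%:R) ^+ 3)).
  by rewrite lerXn2r ?nnegrE ?sqr_ge0 ?divr_ge0// srw_sqr.
rewrite expr_div_n -natrX ler_pdivlMr ?mulr_gt0 ?ltr0n//.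
rewrite mulrAC ler_pdivrMr ?exprn_gt0 ?ltr0n//.
rewrite -!natrX -!natrM ler_nat; nia.
Qed.

End SimpleWalk.

(** * Number of steps along a given axis *)

Section CoordinateCounts.
Context {R : realFieldType} {d : nat} (i : 'I_d.+1).
Let u (_ : 'I_d.+1) : R := d.+1%:R^-1.

Let u_ge0 c : 0 <= u c. Proof. by rewrite invr_ge0. Qed.

Let u_sum1 : \sum_c u c = 1.
Proof. by rewrite /u sumr_const card_ord -[LHS]mulr_natl divff ?pnatr_eq0. Qed.

(* Size-biasing of the binomial law: E[n f(n)] = k p E[f(n + 1)]. *)
Lemma Ex_count_bias k (f : nat -> R) :
  Ex u k.+1 (fun c => (count_mem i c)%:R * f (count_mem i c)) =
  k.+1%:R / d.+1%:R * Ex u k (fun c => f (count_mem i c).+1).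
Proof.
have step n (F : nat -> R) : Ex u n.+1 (fun c => F (count_mem i c)) =
    d.+1%:R^-1 * Ex u n (fun c => F (count_mem i c).+1)
    + (1 - d.+1%:R^-1) * Ex u n (fun c => F (count_mem i c)).
  rewrite ExS (bigD1 i)//= /u eqxx; congr (_ + _).
  rewrite (eq_bigr (fun=> d.+1%:R^-1 * Ex u n (fun c => F (count_mem i c)))).
    rewrite -mulr_suml; congr (_ * _).
    by have := u_sum1; rewrite (bigD1 i)//= => /(canRL (addKr _)) ->; rewrite addrC.
  by move=> c ci; rewrite (negbTE ci).
elim: k f => [|k IHk] f.
  by rewrite (step _ (fun n => n%:R * f n)) /= mul1r mul0r mulr0 addr0 div1r.
rewrite (step _ (fun n => n%:R * f n)) IHk.
rewrite [in RHS](step _ (fun n => f n.+1)).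
rewrite (eq_Ex u (g := fun c => (count_mem i c)%:R * f (count_mem i c).+1
    + f (count_mem i c).+1)); last by move=> c _; rewrite -natr1; ring.
rewrite ExD (IHk (fun n => f n.+1)) (step _ (fun n => f n.+1)).
by rewrite -[k.+2%:R]natr1; field; rewrite nat1r pnatr_eq0.
Qed.

(** Each size-biasing removes one factor of the denominator, costs [(d + 1) / (k + 1)] and raises
    [k] by one; three rounds give the cube. *)
Lemma Ex_count_inv k :
  Ex u k (fun c => ((count_mem i c).+1%:R * (count_mem i c).+2%:R
    * (count_mem i c).+3%:R)^-1)
  <= d.+1%:R ^+ 3 / (k.+1%:R * k.+2%:R * k.+3%:R).
Proof.
have bias n (f : nat -> R) : (forall m, 0 <= f m) ->
    Ex u n (fun c => f (count_mem i c).+1 / (count_mem i c).+1%:R) <=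
    d.+1%:R / n.+1%:R * Ex u n.+1 (fun c => f (count_mem i c)).
  move=> f0; have := Ex_count_bias n (fun m => f m / m%:R).
  move/(congr1 (fun z => d.+1%:R / n.+1%:R * z)).
  rewrite mulrA (_ : _ / _ * (_ / _) = 1) ?mul1r; last by field; rewrite !nat1r !pnatr_eq0.
  move=> <-; apply: ler_wpM2l; first by rewrite divr_ge0.
  (* A zero count contributes nothing to the left side; for every other count the two sides
     agree. *)
  apply: le_Ex => // c _; have [->|n0] := eqVneq (count_mem i c) 0%N.
    by rewrite mul0r.
  by rewrite mulrC divfK// pnatr_eq0.
have h1 n : Ex u n (fun c => (count_mem i c).+1%:R^-1) <= d.+1%:R / n.+1%:R.
  have := bias n (fun=> 1) (fun=> ler01); rewrite Ex_cst// mulr1.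
  by apply: le_trans; apply: le_Ex => // c _; rewrite div1r.
have h2 n : Ex u n (fun c => ((count_mem i c).+1%:R * (count_mem i c).+2%:R)^-1)
    <= d.+1%:R ^+ 2 / (n.+1%:R * n.+2%:R).
  apply: (le_trans (le_Ex (g := fun c =>
    (count_mem i c).+2%:R^-1 / (count_mem i c).+1%:R) _ _)) => //.
    by move=> c _; rewrite invfM mulrC.
  apply: (le_trans (bias n (fun m => m.+1%:R^-1) _)).
    by move=> m; rewrite invr_ge0.
  apply: (le_trans (ler_wpM2l _ (h1 _))); first by rewrite divr_ge0.
  by rewrite expr2 invfM; apply: eq_ler; ring.
apply: (le_trans (le_Ex (g := fun c =>
  ((count_mem i c).+2%:R * (count_mem i c).+3%:R)^-1 / (count_mem i c).+1%:R) _ _)) => //.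
  by move=> c _; rewrite -mulrA invfM mulrC.
apply: (le_trans (bias k (fun m => (m.+1%:R * m.+2%:R)^-1) _)).
  by move=> m; rewrite invr_ge0 mulr_ge0.
apply: (le_trans (ler_wpM2l _ (h2 _))); first by rewrite divr_ge0.
by rewrite exprS !invfM; apply: eq_ler; ring.
Qed.

End CoordinateCounts.

(** * Letters of the walk and heat kernel of its projection *)

Section Walk.
Context {R : realFieldType} {d : nat} (beta mu : R).

Local Notation V := 'rV[int]_d.+1.
Definition letter := ('I_d.+1 * bool * bool)%type.

Definition sg (b : bool) : int := if b then 1 else -1.

(* Letter (c, s, s'): axis c, direction s, except that s' replaces s
   when c is the first axis and the current site was visited before. *)
Definition move (vis : bool) (a : letter) : V :=
  sg (if vis && (a.1.1 == ord0) then a.2 else a.1.2) *: delta_mx ord0 a.1.1.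

(** On the first axis the two signs are independent, the first biased by [beta] and the second by
    [- mu], so that one letter serves new and old sites alike. On the other axes both signs are
    fair. The dimension is [d.+1]. *)
Definition weight (a : letter) : R :=
  (if a.1.1 == ord0
   then (1 + (sg a.1.2)%:~R * beta) / 2 * ((1 - (sg a.2)%:~R * mu) / 2)
   else 1 / 4) / d.+1%:R.

(** The first coordinate is set to zero rather than removed, so that projected sites live in the
    same space as sites. *)
Definition proj (x : V) : V := \row_j (if j == ord0 then 0 else x ord0 j).

Definition pmove (a : letter) : V := proj (move false a).

Definition psum (w : seq letter) : V := \sum_(a <- w) pmove a.

Lemma projD x y : proj (x + y) = proj x + proj y.
Proof. by apply/rowP => j; rewrite !mxE; case: ifP. Qed.

Lemma proj0 : proj 0 = 0.
Proof. by apply/rowP => j; rewrite !mxE; case: ifP. Qed.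

Lemma proj_move vis a : proj (move vis a) = pmove a.
Proof.
apply/rowP => j; rewrite /pmove !mxE; case: ifP => // j0; rewrite eqxx /=.
by have [<-|_] := eqVneq j a.1.1; [rewrite j0 andbF|rewrite !mulr0].
Qed.

Lemma moveE vis a : a.1.1 != ord0 -> move vis a = move false a.
Proof. by rewrite /move => /negbTE->; rewrite andbF. Qed.

Lemma pmove_eq0 a : (pmove a == 0) = (a.1.1 == ord0).
Proof.
apply/eqP/eqP => [/rowP/(_ a.1.1)|a0].
  rewrite !mxE !eqxx; case: eqP => // _ /=; rewrite mulr1.
  by case: a.1.2.
by apply/rowP => j; rewrite !mxE a0; case: ifP => //= ->; rewrite mulr0.
Qed.

Lemma pmove_coord a i : pmove a ord0 i =
  if (i != ord0) && (i == a.1.1) then sg a.1.2 else 0.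
Proof.
by rewrite !mxE eqxx /=; case: eqP => //= _; case: eqP; rewrite ?mulr1 ?mulr0.
Qed.

Lemma psum_nil : psum [::] = 0. Proof. exact: big_nil. Qed.
Lemma psum_cons a w : psum (a :: w) = pmove a + psum w.
Proof. exact: big_cons. Qed.
Lemma psum_cat u v : psum (u ++ v) = psum u + psum v.
Proof. exact: big_cat. Qed.
Lemma psum_rcons w a : psum (rcons w a) = psum w + pmove a.
Proof. by rewrite -cats1 psum_cat psum_cons psum_nil addr0. Qed.

Lemma sum_letter (M : nmodType) (F : letter -> M) : \sum_a F a =
  \sum_(c : 'I_d.+1) ((F (c, true, true) + F (c, true, false))
                    + (F (c, false, true) + F (c, false, false))).
Proof.
rewrite [LHS](eq_bigr (fun a => F (a.1, a.2))); last by case.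
rewrite -(pair_bigA _ (fun x y => F (x, y)))/=.
rewrite (eq_bigr (fun x => F (x, true) + F (x, false))); last first.
  by move=> x _; rewrite big_bool.
rewrite (eq_bigr (fun x => F (x.1, x.2, true) + F (x.1, x.2, false))); last by case.
rewrite -(pair_bigA _ (fun x y => F (x, y, true) + F (x, y, false)))/=.
by apply: eq_bigr => c _; rewrite big_bool.
Qed.

Lemma weight_axis c : (weight (c, true, true) + weight (c, true, false))
  + (weight (c, false, true) + weight (c, false, false)) = d.+1%:R^-1.
Proof. by rewrite /weight /=; case: ifP => _; field; rewrite nat1r pnatr_eq0. Qed.

Lemma weight_axis_mul c z :
  (weight (c, true, true) * z + weight (c, true, false) * z)
  + (weight (c, false, true) * z + weight (c, false, false) * z) = d.+1%:R^-1 * z.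
Proof. by rewrite -(weight_axis c) !mulrDl. Qed.

Lemma weight_sum1 : \sum_a weight a = 1.
Proof.
rewrite sum_letter (eq_bigr (fun=> d.+1%:R^-1)); last first.
  by move=> c _; rewrite weight_axis.
by rewrite sumr_const card_ord -[LHS]mulr_natl divff// pnatr_eq0.
Qed.

Section HeatKernel.
Variable J : {set 'I_d.+1}.
Hypothesis J0 : ord0 \notin J.

(* Given the axes of the steps, the coordinates are independent simple walks. *)
Lemma Ex_psum_coords k (x : V) :
  Ex weight k (fun w => \prod_(i in J) (psum w ord0 i == x ord0 i)%:R) =
  Ex (fun _ : 'I_d.+1 => d.+1%:R^-1) k
    (fun c => \prod_(i in J) srw (count_mem i c) (x ord0 i)).
Proof.
elim: k x => [|k IHk] x.
  by apply: eq_bigr => i _; rewrite psum_nil mxE eq_sym.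
have E a : Ex weight k
    (fun w => \prod_(i in J) (psum (a :: w) ord0 i == x ord0 i)%:R) =
    Ex (fun _ : 'I_d.+1 => d.+1%:R^-1) k (fun c =>
      \prod_(i in J) srw (count_mem i c) (x ord0 i - pmove a ord0 i)).
  rewrite -[RHS](eq_Ex _ (f := fun c =>
      \prod_(i in J) srw (count_mem i c) ((x - pmove a) ord0 i))); last first.
    by move=> c _; apply: eq_bigr => i _; rewrite !mxE.
  rewrite -IHk; apply: eq_Ex => w _; apply: eq_bigr => i _.
  by rewrite psum_cons !mxE addrC eq_sym -subr_eq eq_sym.
rewrite !ExS sum_letter; apply: eq_bigr => c _; rewrite !E -!ExZ -!ExD.
apply: eq_Ex => s _; have [cJ|cJ] := boolP (c \in J).
  have c0 : c != ord0 by apply: contraNneq J0 => <-.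
  have F b b' : \prod_(i in J) srw (R := R) (count_mem i s)
        (x ord0 i - pmove (c, b, b') ord0 i) =
      srw (count_mem c s) (x ord0 c - sg b) *
      \prod_(i in J | i != c) srw (count_mem i s) (x ord0 i).
    rewrite (bigD1 c)//= pmove_coord/= eqxx c0/=; congr (_ * _).
    by apply: eq_bigr => i /andP[_ ic]; rewrite pmove_coord/= (negbTE ic) andbF subr0.
  rewrite !F [in RHS](bigD1 c)//= eqxx add1n /= opprK.
  rewrite [in RHS](eq_bigr (fun i => srw (count_mem i s) (x ord0 i))); last first.
    by move=> i /andP[_ ic]; rewrite eq_sym (negbTE ic).
  by rewrite /weight /= (negbTE c0); field; rewrite nat1r pnatr_eq0.
have F b b' : \prod_(i in J) srw (R := R) (count_mem i s)
      (x ord0 i - pmove (c, b, b') ord0 i) =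
    \prod_(i in J) srw (count_mem i s) (x ord0 i).
  apply: eq_bigr => i iJ; rewrite pmove_coord/=.
  have [ic|] := eqVneq i c; last by rewrite andbF subr0.
  by rewrite -ic iJ in cJ.
have -> : \prod_(i in J) srw (R := R) (count_mem i (c :: s)) (x ord0 i) =
    \prod_(i in J) srw (count_mem i s) (x ord0 i).
  apply: eq_bigr => i iJ /=; have [ic|//] := eqVneq c i.
  by rewrite ic iJ in cJ.
by rewrite !F -(weight_axis c) !mulrDl.
Qed.

End HeatKernel.

(* The decay [k ^- 3] in a form whose double sums telescope. *)
Definition gdec (k : nat) : R := (k.+1%:R * k.+2%:R * k.+3%:R)^-1.

(** Six axes, the 48 of [srw_pow6] and the cube of [Ex_count_inv]. *)
Definition heat_cst : R := 6 * (48 * d.+1%:R ^+ 3).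

Hypothesis weight_ge0 : forall a, 0 <= weight a.
Hypothesis d6 : (6 <= d)%N.

(** Only the coordinates 1 to 6 are kept. Each is a simple walk run for a number of steps of order
    [k], with point probabilities of order [k^(-1/2)]; together they give [k^-3]. *)
Lemma heat_kernel k (x : V) :
  Ex weight k (fun w => (psum w == x)%:R) <= heat_cst * gdec k.
Proof.
pose J : {set 'I_d.+1} := [set inord i.+1 | i : 'I_6].
have iK (i : 'I_6) : (inord i.+1 : 'I_d.+1) = i.+1 :> nat.
  by rewrite inordK//; case: i => i /=; lia.
have J6 : #|J| = 6%N.
  rewrite card_imset ?card_ord// => i j /(congr1 val); rewrite /= !iK.
  by case=> /val_inj.
have J0 : ord0 \notin J.
  by apply/imsetP => -[i _ /(congr1 val)]; rewrite /= iK.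
apply: (@le_trans _ _ (Ex weight k
    (fun w => \prod_(i in J) (psum w ord0 i == x ord0 i)%:R))).
  apply: le_Ex => // w _; case: eqP => [->|_]; last by apply: prodr_ge0.
  by rewrite big1 // => i _; rewrite eqxx.
rewrite Ex_psum_coords// /heat_cst.
apply: (@le_trans _ _ (\sum_(i in J) Ex (fun _ : 'I_d.+1 => d.+1%:R^-1 : R) k
    (fun c => 48 * ((count_mem i c).+1%:R * (count_mem i c).+2%:R
    * (count_mem i c).+3%:R)^-1))).
  rewrite -Ex_sum; apply: le_Ex => [c|c _]; first by rewrite invr_ge0.
  have /card_gt0P[i0 i0J] : (0 < #|J|)%N by rewrite J6.
  pose f i : R := srw (count_mem i c) (x ord0 i).
  have [i iJ imax] := arg_maxP (fun i => f i) i0J.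
  (* The product of six factors is at most the sixth power of the largest, which leaves a single
     count to average; the sum over the axes absorbs the choice of the maximum. *)
  apply: (@le_trans _ _ (f i ^+ 6)).
    rewrite -J6 -prodr_const; apply: ler_prod => j jJ.
    by rewrite srw_ge0; exact: imax.
  apply: le_trans (srw_pow6 _ _) _.
  rewrite (bigD1 i)//= lerDl; apply: sumr_ge0 => j _.
  by rewrite mulr_ge0// invr_ge0 !mulr_ge0.
have -> : 6 = #|J|%:R :> R by rewrite J6.
rewrite -mulrA mulr_natl -sumr_const; apply: ler_sum => i _.
by rewrite ExZ -mulrA ler_wpM2l// Ex_count_inv.
Qed.

Lemma gdec_ge0 k : 0 <= gdec k.
Proof. by rewrite invr_ge0 !mulr_ge0. Qed.

End Walk.

(** * Cut times of trajectories *)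

Section Trajectory.
Context {d : nat}.
Local Notation V := 'rV[int]_d.+1.
Local Notation letter := (@letter d).

(* Positions are listed from the latest to the earliest. *)
Definition trace (w : seq letter) : seq V :=
  foldl (fun h a => (head 0 h + move (head 0 h \in behead h) a) :: h) [:: 0] w.

Definition pos (w : seq letter) : V := head 0 (trace w).

Definition xpos (w : seq letter) : int := pos w ord0 ord0.

Definition fresh (w : seq letter) : bool := pos w \notin behead (trace w).

Lemma trace_rcons w a :
  trace (rcons w a) = (pos w + move (~~ fresh w) a) :: trace w.
Proof. by rewrite /trace foldl_rcons /fresh negbK. Qed.

Lemma trace_head w : trace w = pos w :: behead (trace w).
Proof. by case/lastP: w => [//|w a]; rewrite /pos trace_rcons. Qed.

Lemma pos_rcons w a : pos (rcons w a) = pos w + move (~~ fresh w) a.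
Proof. by rewrite /pos trace_rcons. Qed.

Lemma proj_pos w : proj (pos w) = psum w.
Proof.
elim/last_ind: w => [|w a IHw]; first by rewrite proj0 psum_nil.
by rewrite pos_rcons projD IHw proj_move psum_rcons.
Qed.

(** Turns a coincidence of sites into one of partial sums of projected letters, which no longer
    involves the history. *)
Lemma mem_trace w x : x \in trace w ->
  exists2 i, (i <= size w)%N & proj x = psum (take i w).
Proof.
elim/last_ind: w => [|w a IHw].
  by rewrite inE => /eqP->; exists 0%N => //; rewrite proj0 psum_nil.
rewrite trace_rcons inE => /orP[/eqP->|/IHw[i iw ->]].
  exists (size w).+1; rewrite ?size_rcons// take_oversize ?size_rcons//.
  by rewrite -pos_rcons proj_pos.
exists i; first by rewrite size_rcons ltnW.
by rewrite -cats1 takel_cat.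
Qed.

(* The step taken at a cut time is not along the first axis, hence does not
   depend on whether the current site was visited before. *)
Lemma trace_cat_cut (w v : seq letter) :
    (forall i j, (i <= size w)%N -> (0 < j <= size v)%N ->
      psum (drop i w) + psum (take j v) != 0) ->
  exists2 l, trace v = rcons l 0 &
    trace (w ++ v) = [seq x + pos w | x <- l] ++ trace w.
Proof.
elim/last_ind: v => [|v a IHv] cutwv.
  by exists [::]; rewrite ?cats0.
have /IHv[l tv twv] i j : (i <= size w)%N -> (0 < j <= size v)%N ->
    psum (drop i w) + psum (take j v) != 0.
  move=> iw /andP[j0 jv]; have := cutwv i j iw.
  by rewrite size_rcons j0 (leqW jv) -cats1 takel_cat//; apply.
exists (pos v + move (~~ fresh v) a :: l); first by rewrite trace_rcons tv.
rewrite -rcons_cat trace_rcons twv /=; congr (_ :: _).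
case: l tv twv => [|p l] tv twv.
  have v0 : v = [::].
    by case/lastP: (v) tv => // v' b; rewrite trace_rcons trace_head.
  have a0 : a.1.1 != ord0.
    have := cutwv (size w) 1%N (leqnn _); rewrite v0 drop_size psum_nil add0r.
    by rewrite /= psum_cons psum_nil addr0 pmove_eq0; apply.
  by rewrite v0 cats0 !(moveE _ a0) /pos /= add0r addrC.
have pv : pos v = p by rewrite /pos tv.
have pwv : pos (w ++ v) = p + pos w by rewrite /pos twv.
have sv : (0 < size v)%N.
  by case: (v) tv => //=; rewrite -[trace [::]]/[:: 0]; case: (l).
have full i : (i <= size w)%N -> psum (drop i w) + psum v != 0.
  move=> iw; have := cutwv i (size v) iw; rewrite size_rcons sv leqnSn.
  by rewrite -cats1 take_size_cat//; apply.
rewrite pwv pv addrAC; congr (_ + _ + _); congr (move _ a).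
congr (~~ _); rewrite /fresh pv pwv tv twv /=; congr (~~ _).
(* Freshness agrees in the two walks: meeting the cut site again, or any site before it, would make
   a projected sum straddling the cut vanish. *)
rewrite mem_cat mem_rcons inE.
rewrite (mem_map (addIr (pos w))).
have -> : (p == 0) = false.
  apply/negP => /eqP p0; have := full (size w) (leqnn _).
  by rewrite drop_size psum_nil add0r -proj_pos pv p0 proj0 eqxx.
have -> : (p + pos w \in trace w) = false; last by rewrite orbF.
apply/negP => /mem_trace[i iw]; rewrite projD -pv !proj_pos => e.
have /eqP[] := full i iw; apply: (@addrI _ (psum (take i w))).
rewrite addr0 -[RHS]e -[in RHS](cat_take_drop i w) psum_cat.
by rewrite [RHS]addrC addrA.
Qed.

Lemma xpos_cut (w v : seq letter) :
    (forall i j, (i <= size w)%N -> (0 < j <= size v)%N ->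
      psum (drop i w) + psum (take j v) != 0) ->
  xpos (w ++ v) = xpos w + xpos v.
Proof.
move=> /trace_cat_cut[l tv twv]; rewrite /xpos /pos tv twv.
by case: l {tv twv} => [|p l] /=; rewrite ?mxE ?addr0// addrC.
Qed.

Lemma move_xpos vis a : `|(move vis a : V) ord0 ord0| <= 1.
Proof.
by rewrite !mxE eqxx; case: (ord0 == _); case: (if _ then _ else _).
Qed.

Lemma xpos_cat_le (u v : seq letter) : `|xpos (u ++ v) - xpos u| <= (size v)%:Z.
Proof.
elim/last_ind: v => [|v a IHv]; first by rewrite cats0 subrr.
rewrite size_rcons -rcons_cat /xpos pos_rcons mxE addrAC.
apply: le_trans (ler_normD _ _) _; rewrite -[(size v).+1]addn1 PoszD.
by apply: lerD; [exact: IHv|exact: move_xpos].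
Qed.

Lemma xpos_le (v : seq letter) : `|xpos v| <= (size v)%:Z.
Proof. by have := xpos_cat_le [::] v; rewrite /xpos /= mxE subr0. Qed.

(* A subword straddling time [T] returns to its starting point after
   projection, so that [T] is not a cut time. *)
Definition nocut (w : seq letter) (T : nat) : bool :=
  has (fun a => has (fun b => psum (take (b - a) (drop a w)) == 0)
    (index_iota T.+1 (size w).+1)) (index_iota 0 T.+1).

Lemma nocutP w T : reflect
  (exists a b, [/\ (a <= T)%N, (T < b <= size w)%N &
     psum (take (b - a) (drop a w)) = 0]) (nocut w T).
Proof.
apply: (iffP hasP) => [[a + /hasP[b]]|[a [b [aT bT s0]]]].
  rewrite !mem_index_iota => aT bT /eqP s0; exists a, b; split=> //; lia.
exists a; first by rewrite mem_index_iota ltnS.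
by apply/hasP; exists b; rewrite ?s0// mem_index_iota ltnS.
Qed.

(** A cut [t] letters after the junction cuts both [u ++ v] and [v], so the letters after it
    contribute equally to the two. What remains is the effect of [take t v], at most [t] in each
    walk. *)
Lemma xpos_defect (u v : seq letter) t :
    (t <= size v)%N -> ~~ nocut (u ++ v) (size u + t) ->
  `|xpos (u ++ v) - xpos u - xpos v| <= (t.*2)%:Z.
Proof.
move=> tv /nocutP cut.
(* Used with [k = 0] for the cut of [u ++ v] and with [k = size u] for the cut of [v] alone. *)
have key k i j : (k <= size u)%N -> (i <= size u - k + t)%N ->
    (0 < j <= size v - t)%N ->
    psum (drop i (drop k u ++ take t v)) + psum (take j (drop t v)) != 0.
  move=> ku ik jv; apply/eqP => s0; apply: cut.
  exists (k + i)%N, (size u + t + j)%N; split; [lia|rewrite size_cat; lia|].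
  rewrite -s0 -psum_cat; congr psum.
  have dropl (n : nat) (x y : seq letter) :
      (n <= size x)%N -> drop n (x ++ y) = drop n x ++ y.
    rewrite drop_cat; case: ltnP => // xn nx.
    by rewrite (drop_oversize xn) (_ : n - size x = 0)%N ?drop0//; lia.
  rewrite (addnC k i) -drop_drop dropl// -{1}(cat_take_drop t v) catA dropl; last first.
    by rewrite size_cat size_drop size_takel.
  rewrite take_cat ifF; last by rewrite size_drop size_cat size_drop size_takel//; lia.
  by congr (_ ++ take _ _); rewrite size_drop size_cat size_drop size_takel//; lia.
have st : size (take t v) = t by rewrite size_takel.
have e1 : xpos (u ++ v) = xpos (u ++ take t v) + xpos (drop t v).
  rewrite -{1}(cat_take_drop t v) catA; apply: xpos_cut => i j.
  rewrite size_cat st size_drop => iu jv.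
  by have := key 0%N i j; rewrite drop0 subn0; apply.
have e2 : xpos v = xpos (take t v) + xpos (drop t v).
  rewrite -{1}(cat_take_drop t v); apply: xpos_cut => i j.
  rewrite st size_drop => iu jv.
  by have := key (size u) i j; rewrite drop_size subnn; apply.
have := xpos_cat_le u (take t v); have := xpos_le (take t v).
rewrite e1 e2 st; lia.
Qed.

End Trajectory.

(** * Scarcity of stretches without cut times *)

Lemma sum_telescope_le {R : numDomainType} (f F : nat -> R) s n :
    (forall k, 0 <= F k) -> (forall k, f k = F k - F k.+1) ->
  \sum_(s <= k < n) f k <= F s.
Proof.
move=> F0 fF; have [sn|/ltnW ns] := leqP s n; last by rewrite big_geq.
rewrite (eq_bigr (fun k => - F k.+1 - - F k)); last by move=> k _; rewrite fF opprK addrC.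
by rewrite telescope_sumr// opprK addrC gerDl oppr_le0.
Qed.

(** A Bernoulli inequality, [(1 - q)^K (1 + q K) <= 1], gives the polynomial rate used in the
    variance bound. *)
Lemma geometric_le_inv {R : realFieldType} (q : R) K :
  0 < q <= 1 -> (0 < K)%N -> (1 - q) ^+ K <= (q * K%:R)^-1.
Proof.
move=> /andP[q0 q1] K0; have h n : (1 - q) ^+ n * (1 + q * n%:R) <= 1.
  elim: n => [|n IHn]; first by rewrite expr0 mulr0 addr0 mulr1.
  apply: le_trans IHn; rewrite exprSr -mulrA ler_wpM2l ?exprn_ge0 ?subr_ge0//.
  by rewrite -natr1; have := ler0n R n; nra.
have qK : 0 < q * K%:R by rewrite mulr_gt0// ltr0n.
rewrite -[leRHS]mul1r ler_pdivlMr//; apply: le_trans (h K).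
by rewrite ler_wpM2l ?exprn_ge0 ?subr_ge0// lerDr.
Qed.

Lemma Ex_ge_word {R : realFieldType} {A : finType} (p : A -> R)
    (s : seq A) (f : seq A -> R) :
    (forall a, 0 <= p a) -> (forall w, 0 <= f w) ->
  (\prod_(a <- s) p a) * f s <= Ex p (size s) f.
Proof.
move=> p0; elim: s f => [|a s IHs] f f0 /=; first by rewrite big_nil mul1r.
rewrite big_cons -mulrA (bigD1 a)//= -[leLHS]addr0; apply: lerD.
  by rewrite ler_wpM2l//; apply: (IHs (fun w => f (a :: w))).
by apply: sumr_ge0 => b _; rewrite mulr_ge0//; apply: Ex_ge0.
Qed.

Section CutTimes.
Context {R : realFieldType} {d : nat} (p : @letter d -> R) (C : R).
Local Notation letter := (@letter d).
Local Notation V := 'rV[int]_d.+1.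
Hypothesis p_ge0 : forall a, 0 <= p a.
Hypothesis p_sum1 : \sum_a p a = 1.
Hypothesis C_ge0 : 0 <= C.
Hypothesis heat : forall k (x : V),
  Ex p k (fun w => (psum w == x)%:R) <= C * gdec k.

(** The guard [b] carries the range conditions on the indices. When it fails the expectation is 0,
    so union bounds may run over whole rectangles of indices. *)
Lemma Ex_psum_infix N i k (x : V) (b : bool) : (i + k <= N)%N || ~~ b ->
  Ex p N (fun w => (b && (psum (take k (drop i w)) == x))%:R) <= C * gdec k.
Proof.
case: b => [|_]; last by rewrite Ex0 mulr_ge0// gdec_ge0.
rewrite orbF => ikN.
by rewrite (Ex_infix p_sum1 (fun w => (psum w == x)%:R)).
Qed.

(** A union bound over a rectangle of indices: the decay [k^-3] survives two summations, each
    telescoping, and leaves the inverse of the smallest index sum. *)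
Lemma Ex_union2 N (Q : nat -> nat -> pred (seq letter)) i0 i1 j0 j1 :
    (forall i j, Ex p N (fun w => (Q i j w)%:R) <= C * gdec (i + j)) ->
  Ex p N (fun w => (has (fun i => has (fun j => Q i j w) (index_iota j0 j1))
    (index_iota i0 i1))%:R) <= C / (i0 + j0).+1%:R.
Proof.
move=> HQ.
apply: le_trans (Ex_union p_ge0 _ _
  (fun i w => has (fun j => Q i j w) (index_iota j0 j1))) _.
apply: (@le_trans _ _ (\sum_(i0 <= i < i1)
    C * ((i + j0).+1%:R * (i + j0).+2%:R)^-1)).
  apply: ler_sum => i _.
  apply: le_trans (Ex_union p_ge0 _ _ (fun j w => Q i j w)) _.
  apply: (@le_trans _ _ (\sum_(j0 <= j < j1) C * gdec (i + j))).
    by apply: ler_sum => j _; apply: HQ.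
  rewrite -mulr_sumr ler_wpM2l//.
  apply: le_trans (_ : ((i + j0).+1%:R * (i + j0).+2%:R)^-1 / 2 <= _).
    apply: (sum_telescope_le (F := fun j =>
      ((i + j).+1%:R * (i + j).+2%:R)^-1 / 2)) => k.
      by rewrite divr_ge0// invr_ge0 mulr_ge0.
    rewrite /gdec addnS -!natr1; set x : R := (i + k)%:R.
    have x0 : 0 <= x by [].
    by field; rewrite !lt0r_neq0//; lra.
  rewrite ler_pdivrMr// ler_peMr// ?invr_ge0 ?mulr_ge0//; lra.
rewrite -mulr_sumr ler_wpM2l//.
apply: (sum_telescope_le (F := fun i => ((i + j0).+1%:R)^-1)) => k.
  by rewrite invr_ge0.
rewrite addSn -!natr1; set x : R := (k + j0)%:R.
have x0 : 0 <= x by [].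
by field; rewrite !lt0r_neq0//; lra.
Qed.

(* Intersections straddling [T] that leave the window of radius [l]. *)
Definition farcut (l : nat) (w : seq letter) (T : nat) : bool :=
  let Q i j := [&& (i <= T)%N, (T + j <= size w)%N &
                   psum (take (i + j) (drop (T - i) w)) == 0] in
  has (fun i => has (Q i) (index_iota 1 (size w).+1)) (index_iota l T.+1) ||
  has (fun i => has (Q i) (index_iota l (size w).+1)) (index_iota 0 T.+1).

Lemma Ex_farcut l N T :
  Ex p N (fun w => (farcut l w T)%:R) <= 2 * C / l.+1%:R.
Proof.
pose Q i j (w : seq letter) := ((i <= T)%N && (T + j <= N)%N) &&
  (psum (take (i + j) (drop (T - i) w)) == 0).
have HQ i j : Ex p N (fun w => (Q i j w)%:R) <= C * gdec (i + j).
  by apply: Ex_psum_infix; lia.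
have h1 := Ex_union2 l T.+1 1 N.+1 HQ.
have h2 := Ex_union2 0 T.+1 l N.+1 HQ.
apply: (@le_trans _ _ (C / (l + 1).+1%:R + C / (0 + l).+1%:R)).
  apply: le_trans (lerD h1 h2); rewrite -ExD; apply: le_Ex => // w sw.
  rewrite /farcut sw.
  under eq_has => i do under eq_has => j do rewrite andbA.
  under [X in _ || X]eq_has => i do under eq_has => j do rewrite andbA.
  by rewrite /Q; case: has; case: has => /=; rewrite ?addr0 ?add0r// lerDl.
rewrite add0n -mulrA mulr_natl mulr2n lerD2r ler_wpM2l//.
by rewrite lef_pV2 ?posrE ?ltr0n// ler_nat; lia.
Qed.

(** Replaces [nocut] by an event on [2 l] letters, independent over disjoint windows, at the price
    of the rare event [farcut]: a straddling return either stays in the window or leaves it on one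
    side. *)
Lemma nocut_local l w T : (l <= T)%N -> (T + l <= size w)%N -> nocut w T ->
  nocut (take l.*2 (drop (T - l) w)) l || farcut l w T.
Proof.
move=> lT Tl /nocutP[a [b [aT /andP[Tb bw] s0]]].
have [far|near] := boolP ((a + l <= T)%N || (T + l <= b)%N).
  apply/orP; right; apply/orP; case/orP: far => far; [left|right].
    apply/hasP; exists (T - a)%N; first by rewrite mem_index_iota; lia.
    apply/hasP; exists (b - T)%N; first by rewrite mem_index_iota; lia.
    rewrite leq_subr subnKC ?(ltnW Tb)// bw /=.
    by rewrite subKn// (_ : _ + _ = b - a)%N ?s0//; lia.
  apply/hasP; exists (T - a)%N; first by rewrite mem_index_iota; lia.
  apply/hasP; exists (b - T)%N; first by rewrite mem_index_iota; lia.
  rewrite leq_subr subnKC ?(ltnW Tb)// bw /=.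
  by rewrite subKn// (_ : _ + _ = b - a)%N ?s0//; lia.
apply/orP; left; apply/nocutP; exists (a - (T - l))%N, (b - (T - l))%N.
have sz : size (take l.*2 (drop (T - l) w)) = l.*2.
  by rewrite size_takel// size_drop; lia.
split; [lia|rewrite sz; lia|].
rewrite -s0; congr psum.
rewrite -[in RHS](@subnK (T - l) a); last lia.
rewrite -drop_drop; set x := drop (T - l) w.
have -> : (b - (T - l) - (a - (T - l)) = b - (a - (T - l) + (T - l)))%N by lia.
rewrite -[in RHS](cat_take_drop l.*2 x) drop_cat ifT ?sz; last lia.
by rewrite takel_cat// size_drop sz; lia.
Qed.

(** Unless some centre has a far intersection, which a union bound over the [K] centres controls,
    all the independent window events occur, with probability at most [r ^+ K]. *)
Lemma Ex_nocut_all N n l K (r : R) : (n + l.*2 * K <= N)%N ->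
    Ex p l.*2 (fun w => (nocut w l)%:R) <= r ->
  Ex p N (fun w => (all (fun j => nocut w (n + l.*2 * j + l)) (iota 0 K))%:R) <=
  r ^+ K + K%:R * (2 * C / l.+1%:R).
Proof.
move=> nN Hr.
have h1 : Ex p N (fun w => \prod_(j < K)
    (nocut (take l.*2 (drop (n + l.*2 * j) w)) l)%:R) <= r ^+ K.
  pose F (v : seq letter) : R := \prod_(j < K) (nocut (take l.*2 (drop (j * l.*2) v)) l)%:R.
  have -> : N = (n + (N - n))%N by lia.
  rewrite (eq_Ex p (g := fun w => F (drop n w))); last first.
    move=> w _; apply: eq_bigr => j _.
    by rewrite drop_drop [(_ * l.*2)%N]mulnC addnC.
  rewrite Ex_drop// (Ex_blocks p_sum1 (fun w => (nocut w l)%:R)); last first.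
    by rewrite mulnC; lia.
  rewrite lerXn2r// nnegrE; first exact: Ex_ge0.
  by apply: le_trans Hr; exact: Ex_ge0.
have h2 : Ex p N (fun w => \sum_(j < K) (farcut l w (n + l.*2 * j + l))%:R) <=
    K%:R * (2 * C / l.+1%:R).
  rewrite Ex_sum mulr_natl.
  rewrite -[X in _ *+ X]card_ord -sumr_const.
  by apply: ler_sum => j _; exact: Ex_farcut.
apply: le_trans (lerD h1 h2); rewrite -ExD; apply: le_Ex => // w sw.
have prod0 : 0 <= \prod_(j < K)
    (nocut (take l.*2 (drop (n + l.*2 * j) w)) l)%:R :> R by apply: prodr_ge0.
case: allP => [allT|_]; last by rewrite addr_ge0// sumr_ge0.
have [/existsP[j fj]|/existsPn nofar] :=
  boolP [exists j : 'I_K, farcut l w (n + l.*2 * j + l)].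
  by rewrite [X in _ + X](bigD1 j)//= fj addrCA lerDl addr_ge0// sumr_ge0.
rewrite big1 ?lerDl ?sumr_ge0// => j _.
have jK : (n + l.*2 * j + l.*2 <= N)%N.
  by apply: leq_trans nN; rewrite -addnA -mulnSr leq_add2l leq_mul2l ltn_ord orbT.
have := @nocut_local l w (n + l.*2 * j + l).
rewrite addnK sw leq_addl (negbTE (nofar j)) orbF => -> //; first lia.
by apply: allT; rewrite mem_iota /=.
Qed.

End CutTimes.

Lemma has_iota2 (Q : nat -> nat -> bool) i0 i1 j0 j1 i j :
    (i0 <= i < i1)%N -> (j0 <= j < j1)%N -> Q i j ->
  has (fun i => has (Q i) (index_iota j0 j1)) (index_iota i0 i1).
Proof.
move=> hi hj Qij; apply/hasP; exists i; first by rewrite mem_index_iota.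
by apply/hasP; exists j; first by rewrite mem_index_iota.
Qed.

(** * Cut times produced by straight segments *)

Section StraightLine.
Context {R : realFieldType} {d : nat} (p : @letter d -> R) (C : R) (e : @letter d).
Local Notation letter := (@letter d).
Local Notation V := 'rV[int]_d.+1.
Hypothesis p_ge0 : forall a, 0 <= p a.
Hypothesis p_sum1 : \sum_a p a = 1.
Hypothesis C_ge0 : 0 <= C.
Hypothesis heat : forall k (x : V),
  Ex p k (fun w => (psum w == x)%:R) <= C * gdec k.
Hypothesis e_axis : e.1.1 != ord0.

Lemma psum_coord_le (w : seq letter) i : `|psum w ord0 i| <= (size w)%:Z.
Proof.
elim: w => [|a w IHw]; first by rewrite psum_nil mxE.
rewrite psum_cons mxE /= -[(size w).+1]add1n PoszD.
apply: le_trans (ler_normD _ _) _; apply: lerD => //.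
by rewrite pmove_coord; case: ifP => // _; case: a.1.2.
Qed.

Lemma norm_pmove_mulrn r : `|(pmove e *+ r) ord0 e.1.1| = r%:Z.
Proof.
have -> : (pmove e *+ r) ord0 e.1.1 = pmove e ord0 e.1.1 *+ r.
  elim: r => [|r IHr]; first by rewrite !mulr0n mxE.
  by rewrite !mulrS [LHS]mxE IHr.
rewrite normrMn pmove_coord eqxx e_axis /=.
by case: e.1.2; rewrite -mulr_natl mulr1 natz.
Qed.

(** For [w] of length [2 m] the segment sits in the middle, and its own centre is the time [m + M]
    at which a cut is sought. *)
Definition detour (m M : nat) (w : seq letter) : seq letter :=
  take m w ++ nseq M.*2 e ++ drop m w.

(* After a straight segment of length [2M], a return must compensate the part
   of the segment it contains, which takes at least as many further steps. *)
Lemma nocut_detour m M w : size w = m.*2 -> nocut (detour m M w) (m + M) ->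
  exists i j r, [/\ (i <= m)%N && (j <= m)%N,
    psum (take (i + j) (drop (m - i) w)) = - (pmove e *+ r) &
    (exists k l, [/\ i = (l + k)%N, j = 0%N, r = (M + k)%N,
                     (1 <= k < M.+1)%N & (M <= l)%N]) \/
    ((exists k l, [/\ i = 0%N, j = (l + k)%N, r = (M + k)%N,
                     (k < M.+1)%N & (M <= l)%N]) \/
     [/\ r = M.*2, (0 < i)%N, (0 < j)%N & (M <= i)%N || (M <= j)%N])].
Proof.
move=> sw /nocutP[a [b [aT /andP[Tb bB] s0]]].
have take_catE (T : Type) n (x y : seq T) :
    take n (x ++ y) = take n x ++ take (n - size x) y.
  rewrite take_cat; case: ltnP => h; last by rewrite (take_oversize h).
  have -> : (n - size x = 0)%N by lia.
  by rewrite take0 cats0.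
have psum_nseq n : psum (nseq n e) = pmove e *+ n.
  by elim: n => [|n IHn]; rewrite ?psum_nil//= psum_cons IHn mulrS.
have takeN k n : take k (nseq n e) = nseq (minn k n) e.
  by elim: n k => [|n IHn] [|k] //=; rewrite IHn minnSS.
have sm : size (take m w) = m by rewrite size_takel// sw; lia.
have sB : size (detour m M w) = (m.*2 + M.*2)%N.
  by rewrite !size_cat sm size_nseq size_drop sw; lia.
have pt n : psum (take n (detour m M w)) = psum (take n (take m w))
    + pmove e *+ minn (n - m) M.*2 + psum (take (n - m - M.*2) (drop m w)).
  rewrite /detour !take_catE !psum_cat sm size_nseq addrA.
  by rewrite takeN psum_nseq.
have sub : psum (take b (detour m M w)) = psum (take a (detour m M w)).
  rewrite -[b in LHS](@subnKC a b); last lia.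
  by rewrite takeD psum_cat s0 addr0.
set i := (m - a)%N; set j := (b - m - M.*2)%N.
set r := (minn (b - m) M.*2 - (a - m))%N.
have h : psum (take (i + j) (drop (m - i) w)) = - (pmove e *+ r).
  have -> : psum (take (i + j) (drop (m - i) w)) =
      psum (drop a (take m w)) + psum (take j (drop m w)).
    rewrite takeD psum_cat drop_drop (_ : i + (m - i) = m)%N; last lia.
    congr (psum _ + _); rewrite take_drop subnKC; last lia.
    have [am|ma] := leqP a m; first by rewrite subKn.
    by rewrite (_ : m - i = m)%N ?drop_oversize ?sm//; lia.
  move: sub; rewrite !pt [take b _]take_oversize ?sm; last lia.
  rewrite (_ : a - m - M.*2 = 0)%N; last lia.
  rewrite take0 psum_nil addr0 -[in psum (take m w)](cat_take_drop a (take m w)).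
  rewrite psum_cat (_ : minn (b - m) M.*2 = minn (a - m) M.*2 + r)%N; last lia.
  rewrite mulrnDr -!addrA => /addrI; rewrite -[in RHS](addr0 (_ *+ minn _ _)).
  rewrite addrCA => /addrI; rewrite -/j => /eqP.
  by rewrite addrCA addr_eq0 => /eqP ->; rewrite opprK.
have rij : (r <= i + j)%N.
  have := psum_coord_le (take (i + j) (drop (m - i) w)) e.1.1.
  rewrite h mxE normrN norm_pmove_mulrn size_takel; first by [].
  by rewrite size_drop sw; lia.
have Ei : i = (m - a)%N by [].
have Ej : j = (b - m - M.*2)%N by [].
have Er : r = (minn (b - m) M.*2 - (a - m))%N by [].
exists i, j, r; split=> //; first by rewrite sB in bB; lia.
(* Here [i] and [j] count the letters of [w] before and after the segment, and [r] those of the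
   segment. If [i = j = 0] the return lies inside the segment, where [0 < r] contradicts [rij]; if
   both are positive the whole segment is crossed and [r = 2 M]. *)
have [i0|i0] := posnP i; have [j0|j0] := posnP j.
- by lia.
- right; left; exists (M - (a - m))%N, (j - (M - (a - m)))%N.
  by split; lia.
- left; exists (b - m - M)%N, (i - (b - m - M))%N.
  by split; lia.
- by right; right; split; lia.
Qed.

(** The heat kernel bound is uniform in the target, so the displacement of the segment is harmless.
    The possible returns form four two-index families with index sum at least [M]; each has
    probability at most [C / (M + 1) <= 1 / 8], uniformly in [m]. *)
Lemma Ex_nocut_detour m M : 8 * C <= M.+1%:R ->
  Ex p m.*2 (fun w => (nocut (detour m M w) (m + M))%:R) <= 1 / 2.
Proof.
move=> CM.
pose F i j r (w : seq letter) := ((i <= m)%N && (j <= m)%N) &&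
  (psum (take (i + j) (drop (m - i) w)) == - (pmove e *+ r)).
have HF i j r : Ex p m.*2 (fun w => (F i j r w)%:R) <= C * gdec (i + j).
  by apply: Ex_psum_infix => //; lia.
pose H (Q : nat -> nat -> pred (seq letter)) i0 i1 j0 j1 w :=
  has (fun i => has (fun j => Q i j w) (index_iota j0 j1)) (index_iota i0 i1).
pose B1 := H (fun k l => F (l + k)%N 0%N (M + k)%N) 1%N M.+1 M m.+1.
pose B2 := H (fun k l => F 0%N (l + k)%N (M + k)%N) 0%N M.+1 M m.+1.
pose B3 := H (fun i j => F i j M.*2) M m.+1 1%N m.+1.
pose B4 := H (fun i j => F i j M.*2) 1%N m.+1 M m.+1.
have cover w : size w = m.*2 -> nocut (detour m M w) (m + M) ->
    [|| B1 w, B2 w, B3 w | B4 w].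
  move=> sw /(nocut_detour sw)[i [j [r [ijm hij]]]].
  have Fij : F i j r w by rewrite /F ijm hij eqxx.
  have [im jm] := andP ijm.
  case=> [[k [l [ei ej er kM Ml]]]|[[k [l [ei ej er kM Ml]]]|[er i0 j0 /orP Mij]]].
  - have -> // : B1 w; apply: (has_iota2 kM (_ : M <= l < m.+1)%N); first lia.
    by rewrite -er -ei -ej.
  - have -> : B2 w; last by rewrite orbT.
    apply: (has_iota2 (_ : 0 <= k < M.+1)%N (_ : M <= l < m.+1)%N) => //; first lia.
    by rewrite -er -ej -ei.
  case: Mij => Mij.
    have -> : B3 w; last by rewrite !orbT.
    by apply: (has_iota2 (_ : M <= i < m.+1)%N (_ : 1 <= j < m.+1)%N);
      rewrite ?Mij ?j0 ?ltnS// -er.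
  have -> : B4 w; last by rewrite !orbT.
  by apply: (has_iota2 (_ : 1 <= i < m.+1)%N (_ : M <= j < m.+1)%N);
    rewrite ?Mij ?i0 ?ltnS// -er.
have U (Q : nat -> nat -> pred (seq letter)) (i0 i1 j0 j1 : nat) : (M <= i0 + j0)%N ->
    (forall i j, Ex p m.*2 (fun w => (Q i j w)%:R) <= C * gdec (i + j)) ->
    Ex p m.*2 (fun w => (H Q i0 i1 j0 j1 w)%:R) <= C / M.+1%:R.
  move=> Mij HQ; apply: le_trans (Ex_union2 p_ge0 C_ge0 i0 i1 j0 j1 HQ) _.
  by rewrite ler_wpM2l// lef_pV2 ?posrE ?ltr0n// ler_nat; lia.
have h1 : Ex p m.*2 (fun w => (B1 w)%:R) <= C / M.+1%:R.
  by apply: U => [|k l]; [lia|rewrite (addnC k l) -[X in gdec X]addn0; exact: HF].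
have h2 : Ex p m.*2 (fun w => (B2 w)%:R) <= C / M.+1%:R.
  by apply: U => [|k l]; [lia|rewrite (addnC k l); exact: (HF 0%N)].
have h3 : Ex p m.*2 (fun w => (B3 w)%:R) <= C / M.+1%:R by apply: U => //; lia.
have h4 : Ex p m.*2 (fun w => (B4 w)%:R) <= C / M.+1%:R by apply: U => //; lia.
apply: (@le_trans _ _ (C / M.+1%:R + C / M.+1%:R + (C / M.+1%:R + C / M.+1%:R))).
  apply: le_trans (lerD (lerD h1 h2) (lerD h3 h4)).
  rewrite -!ExD; apply: le_Ex => // w sw.
  case: nocut (cover w sw) => [/(_ isT)|_]; last by rewrite !addr_ge0.
  by case: (B1 w); case: (B2 w); case: (B3 w); case: (B4 w) => //= _; lra.
have M0 : 0 < M.+1%:R :> R by rewrite ltr0n.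
have : C / M.+1%:R <= 1 / 8 by rewrite ler_pdivrMr//; lra.
by move: (C / _) => x; lra.
Qed.

Hypothesis pe_gt0 : 0 < p e.

Lemma weight_le1 a : p a <= 1.
Proof. by rewrite -p_sum1 (bigD1 a)//= lerDl sumr_ge0. Qed.

(** The middle [2 M] letters all equal [e] with probability [p e ^+ M.*2], and then the centre is a
    cut with probability at least 1/2. The bound does not depend on [l]. *)
Lemma Ex_nocut_window M l : 8 * C <= M.+1%:R -> (M <= l)%N ->
  Ex p l.*2 (fun w => (nocut w l)%:R) <= 1 - p e ^+ M.*2 / 2.
Proof.
move=> CM Ml; set m := (l - M)%N; pose f (w : seq letter) : R := 1 - (nocut w l)%:R.
have f0 w : 0 <= f w by rewrite /f; case: nocut; rewrite ?subr0 ?subrr.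
suff : p e ^+ M.*2 / 2 <= Ex p l.*2 f.
  rewrite /f ExB Ex_cst//; set x := _ / 2; lra.
have -> : l.*2 = (m + (M.*2 + m))%N by rewrite /m; lia.
apply: (@le_trans _ _ (Ex p m (fun u =>
    p e ^+ M.*2 * Ex p m (fun v => f (u ++ nseq M.*2 e ++ v))))).
  have -> : Ex p m (fun u => p e ^+ M.*2 *
      Ex p m (fun v => f (u ++ nseq M.*2 e ++ v))) =
      p e ^+ M.*2 * Ex p m.*2 (fun w => f (detour m M w)).
    rewrite ExZ -[m.*2]addnn Ex_cat; congr (_ * _); apply: eq_Ex => u su.
    by apply: eq_Ex => v _; rewrite /detour take_size_cat// drop_size_cat.
  rewrite ler_wpM2l ?exprn_ge0//.
  have := @Ex_nocut_detour m M CM; rewrite /m subnK// /f ExB Ex_cst//; lra.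
rewrite Ex_cat; apply: le_Ex => // u _; rewrite Ex_cat.
have := Ex_ge_word (nseq M.*2 e) (f := fun s => Ex p m (fun v => f (u ++ s ++ v))) p_ge0.
rewrite size_nseq big_nseq -Monoid.iteropE => h.
by apply: le_trans (h _); [rewrite /GRing.exp|move=> w; exact: Ex_ge0].
Qed.

End StraightLine.

(** * Variance of the displacement *)

Section Variance.
Context {R : realFieldType} {d : nat} (p : @letter d -> R) (C : R) (e : @letter d)
  (M : nat).
Local Notation letter := (@letter d).
Local Notation V := 'rV[int]_d.+1.
Hypothesis p_ge0 : forall a, 0 <= p a.
Hypothesis p_sum1 : \sum_a p a = 1.
Hypothesis C_ge0 : 0 <= C.
Hypothesis heat : forall k (x : V),
  Ex p k (fun w => (psum w == x)%:R) <= C * gdec k.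
Hypothesis e_axis : e.1.1 != ord0.
Hypothesis pe_gt0 : 0 < p e.
Hypothesis CM : 8 * C <= M.+1%:R.

Definition defect (n : nat) (w : seq letter) : R :=
  (xpos w - xpos (take n w) - xpos (drop n w))%:~R.

(** The 16 comes from words with a cut at some block centre, the next two terms from words without
    one, and the last from small [K]. *)
Definition defect_cst : R := 16 + 8 / p e ^+ M.*2 + 8 * C + 4 * M.+2%:R.

Lemma sqr_intr_le (z : int) (k : nat) : `|z| <= k%:Z -> (z%:~R : R) ^+ 2 <= k%:R ^+ 2.
Proof.
move=> zk; rewrite -[leLHS]ger0_norm ?sqr_ge0// normrX lerXn2r ?nnegrE//.
by rewrite -intr_norm -[k%:R]/(k%:~R) ler_int.
Qed.

Lemma defect_sqr_le n m w : size w = (n + m)%N ->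
  defect n w ^+ 2 <= (m.*2)%:R ^+ 2.
Proof.
move=> sw; apply: sqr_intr_le.
have := xpos_cat_le (take n w) (drop n w); have := xpos_le (drop n w).
by rewrite cat_take_drop size_drop sw addKn; lia.
Qed.

(* Cut times are sought at the centres of [K] consecutive blocks of length
   [2 K ^ 2] at the beginning of a word of length [K ^ 4]. *)
Lemma Ex_defect_sqr n K : (0 < K)%N ->
  Ex p (n + K ^ 4) (fun w => defect n w ^+ 2) <= defect_cst * K%:R ^+ 7.
Proof.
move=> K0; have K1 : 1 <= K%:R :> R by rewrite ler1n.
have q0 : 0 < p e ^+ M.*2 by rewrite exprn_gt0.
have K7 : 0 <= K%:R ^+ 7 :> R by rewrite exprn_ge0.
(* For small [K] the trivial bound [(2 K^4)^2 = 4 K^8] is at most [4 (M + 2) K^7]. For larger [K]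
   the block radius [K^2] exceeds [M]. *)
have [KM|KM] := ltnP K M.+2.
  apply: (@le_trans _ _ (4 * M.+2%:R * K%:R ^+ 7)); last first.
    rewrite ler_wpM2r// /defect_cst lerDr !addr_ge0// ?mulr_ge0//.
    by rewrite invr_ge0 ltW.
  apply: Ex_le_cst => // w sw; apply: le_trans (defect_sqr_le sw) _.
  rewrite -!natrX -!natrM ler_nat -mul2n expnMn -expnM -[(4 * 2)%N]/8%N (expnS K 7).
  by rewrite mulnA leq_mul2r -[(2 ^ 2)%N]/4%N leq_mul2l (ltnW KM) !orbT.
set l := (K ^ 2)%N.
have lM : (M <= l)%N by rewrite /l; nia.
pose allb (w : seq letter) := all (fun j => nocut w (n + l.*2 * j + l)) (iota 0 K).
have lK : (l.*2 * K <= K ^ 4)%N by rewrite /l -mul2n -mulnA -expnSr [in leqRHS]expnS leq_mul2r; lia.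
(* A cut at one of the centres comes at most [2 K^3] letters after the junction, so the defect is at
   most [4 K^3]. Otherwise the trivial bound [2 K^4] is used, on an event of probability of order
   [1 / K]. *)
have step w : size w = (n + K ^ 4)%N ->
    defect n w ^+ 2 <= 16 * K%:R ^+ 6 + (allb w)%:R * (4 * K%:R ^+ 8).
  move=> sw; case: (boolP (allb w)) => [_|/allPn[j]].
    apply: le_trans (defect_sqr_le sw) _.
    have -> : (K ^ 4).*2%:R ^+ 2 = 4 * K%:R ^+ 8 :> R by rewrite -mul2n natrM natrX; ring.
    by rewrite mul1r lerDr mulr_ge0// exprn_ge0.
  rewrite mem_iota add0n => /andP[_ jK] cut.
  rewrite mul0r addr0.
  have tK : (l.*2 * j + l <= (K ^ 3).*2)%N.
    rewrite /l -[in leqRHS]mul2n expnS mulnCA -mul2n.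
    have : (j.+1 <= K)%N by []. nia.
  have sd : size (drop n w) = (K ^ 4)%N by rewrite size_drop sw addKn.
  have st : size (take n w) = n by rewrite size_takel// sw leq_addr.
  have := @xpos_defect d (take n w) (drop n w) (l.*2 * j + l).
  rewrite cat_take_drop sd st addnA => /(_ _ cut).
  have tv : (l.*2 * j + l <= K ^ 4)%N by apply: leq_trans lK; nia.
  move=> /(_ tv) h.
  have : `|xpos w - xpos (take n w) - xpos (drop n w)| <= (4 * K ^ 3)%N%:Z.
    by apply: le_trans h _; rewrite lez_nat; lia.
  move/sqr_intr_le => {}h; apply: le_trans h _; apply: eq_ler.
  by rewrite natrM natrX; ring.
apply: (le_trans (le_Ex p_ge0 step)).
rewrite ExD Ex_cst// ExZr.
have h := @Ex_nocut_all R d p C p_ge0 p_sum1 C_ge0 heat (n + K ^ 4)%N n l K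
  (1 - p e ^+ M.*2 / 2).
have {}h := h _ (Ex_nocut_window p_ge0 p_sum1 C_ge0 heat e_axis pe_gt0 CM lM).
apply: (@le_trans _ _ (16 * K%:R ^+ 6 +
    ((p e ^+ M.*2 / 2 * K%:R)^-1 + 2 * C / K%:R) * (4 * K%:R ^+ 8))).
  rewrite lerD2l ler_wpM2r ?mulr_ge0 ?exprn_ge0//.
  apply: le_trans (h _) _; first by rewrite leq_add2l.
  apply: lerD.
    apply: geometric_le_inv => //; rewrite divr_gt0//=.
    have : p e ^+ M.*2 <= 1 by rewrite exprn_ile1// ?weight_le1// ltW.
    lra.
  rewrite mulrCA ler_wpM2l ?mulr_ge0// ler_pdivrMr ?ltr0n//.
  rewrite ler_pdivlMl ?ltr0n// -natrM ler_nat /l; nia.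
rewrite /defect_cst.
have -> : 16 * K%:R ^+ 6 + ((p e ^+ M.*2 / 2 * K%:R)^-1 + 2 * C / K%:R) * (4 * K%:R ^+ 8)
  = 16 * K%:R ^+ 6 + (8 / p e ^+ M.*2 + 8 * C) * K%:R ^+ 7 :> R.
  by field; rewrite gt_eqF//= gt_eqF// ltr0n.
have k67 : K%:R ^+ 6 <= K%:R ^+ 7 :> R by rewrite ler_weXn2l.
have M0 : 0 <= M.+2%:R :> R by [].
have MK := mulr_ge0 M0 K7.
rewrite !mulrDl; nra.
Qed.

Definition xmean (m : nat) : R := Ex p m (fun w => (xpos w)%:~R).

(** Each block is run as a fresh walk from the origin, so the summands are independent and
    centred. *)
Definition mart (m N : nat) (w : seq letter) : R :=
  \sum_(i < N) ((xpos (take m (drop (i * m) w)))%:~R - xmean m).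

Lemma martS m N u v : size u = (N * m)%N -> size v = m ->
  mart m N.+1 (u ++ v) = mart m N u + ((xpos v)%:~R - xmean m).
Proof.
move=> su sv; rewrite /mart big_ord_recr /=; congr (_ + (_%:~R - _)).
  apply: eq_bigr => i _; congr ((xpos _)%:~R - _).
  have im : (i * m + m <= N * m)%N by rewrite -mulSnr leq_mul2r ltn_ord orbT.
  have [sm|] := ltnP (i * m) (N * m).
    by rewrite drop_cat su sm takel_cat// size_drop su; lia.
  move=> h; have -> : m = 0%N by lia.
  by rewrite !take0.
by rewrite drop_size_cat// take_oversize// sv.
Qed.

Lemma xmean_centered m : Ex p m (fun v => (xpos v)%:~R - xmean m) = 0.
Proof. by rewrite ExB Ex_cst// subrr. Qed.

Lemma Ex_mart m N : Ex p (N * m) (mart m N) = 0.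
Proof.
elim: N => [|N IHN]; first by rewrite /mart /= big_ord0.
rewrite mulSnr Ex_cat (eq_Ex p (g := mart m N)) ?IHN// => u su.
rewrite (eq_Ex p (g := fun v => mart m N u + ((xpos v)%:~R - xmean m))).
  by rewrite ExD Ex_cst// xmean_centered addr0.
by move=> v sv; rewrite martS.
Qed.

Lemma Ex_mart_sqr m N :
  Ex p (N * m) (fun w => mart m N w ^+ 2) <= N%:R * m%:R ^+ 2.
Proof.
elim: N => [|N IHN]; first by rewrite /mart /= big_ord0 expr2 !mul0r.
rewrite mulSnr Ex_cat.
have var : Ex p m (fun v => ((xpos v)%:~R - xmean m) ^+ 2) <= m%:R ^+ 2.
  rewrite (eq_Ex p (g := fun v =>
    (xpos v)%:~R ^+ 2 - 2 * xmean m * (xpos v)%:~R + xmean m ^+ 2)); last first.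
    by move=> v _; ring.
  rewrite ExD ExB ExZ Ex_cst// -/(xmean m).
  have : Ex p m (fun v => (xpos v)%:~R ^+ 2) <= m%:R ^+ 2.
    by apply: Ex_le_cst => // v <-; apply: sqr_intr_le; exact: xpos_le.
  by have := sqr_ge0 (xmean m); nra.
rewrite (eq_Ex p (g := fun u => mart m N u ^+ 2 +
    Ex p m (fun v => ((xpos v)%:~R - xmean m) ^+ 2))).
  by rewrite ExD Ex_cst// -natr1 mulrDl mul1r lerD.
move=> u su; rewrite (eq_Ex p (g := fun v =>
    (mart m N u ^+ 2 + 2 * mart m N u * ((xpos v)%:~R - xmean m))
    + ((xpos v)%:~R - xmean m) ^+ 2)); last first.
  by move=> v sv; rewrite martS//; ring.
by rewrite !ExD ExZ xmean_centered mulr0 addr0 Ex_cst.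
Qed.

(** The accumulated junction errors: appending a block adds exactly one [defect], as [residS]
    states. *)
Definition resid (m N : nat) (w : seq letter) : R :=
  (xpos w)%:~R - N%:R * xmean m - mart m N w.

Lemma xpos_nil : xpos ([::] : seq letter) = 0.
Proof. by rewrite /xpos /pos /= mxE. Qed.

Lemma resid0 m w : resid m 0 w = (xpos w)%:~R.
Proof. by rewrite /resid /mart big_ord0 mul0r !subr0. Qed.

Lemma residS m N u v : size u = (N * m)%N -> size v = m ->
  resid m N.+1 (u ++ v) = resid m N u + defect (N * m) (u ++ v).
Proof.
move=> su sv; rewrite /resid martS// /defect take_size_cat// drop_size_cat//.
by rewrite !rmorphB /= -natr1; ring.
Qed.

(** The triangle inequality in mean square, in the form [(x + y)^2 <= (1 + 1/n) x^2 + (1 + n) y^2],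
    whose weights turn the factor [n^2] into [(n + 1)^2]. *)
Lemma Ex_resid_sqr N K : (0 < K)%N ->
  Ex p (N * K ^ 4) (fun w => resid (K ^ 4) N w ^+ 2) <=
  N%:R ^+ 2 * (defect_cst * K%:R ^+ 7).
Proof.
move=> K0; set m := (K ^ 4)%N; set B := _ * _ ^+ 7.
elim: N => [|N IHN].
  by rewrite mul0n /= resid0 xpos_nil !expr2 !mul0r.
rewrite mulSnr.
have dN : Ex p (N * m + m) (fun w => defect (N * m) w ^+ 2) <= B.
  exact: Ex_defect_sqr.
have rS : Ex p (N * m + m) (fun w => resid m N.+1 w ^+ 2) =
    Ex p (N * m + m) (fun w => (resid m N (take (N * m) w) + defect (N * m) w) ^+ 2).
  apply: eq_Ex => w sw; rewrite -{1}(cat_take_drop (N * m) w) residS ?cat_take_drop//.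
    by rewrite size_takel// sw leq_addr.
  by rewrite size_drop sw addKn.
rewrite rS; case: N IHN dN {rS} => [|N] IHN dN.
  rewrite expr1n mul1r; apply: le_trans dN; apply: eq_ler; apply: eq_Ex => w _.
  by rewrite mul0n take0 resid0 xpos_nil add0r.
have N0 : 0 < N.+1%:R :> R by rewrite ltr0n.
set n := N.+1 in IHN dN N0 *.
apply: (@le_trans _ _ ((1 + n%:R^-1) * (n%:R ^+ 2 * B) + (1 + n%:R) * B)); last first.
  by apply: eq_ler; rewrite -natr1; field; rewrite gt_eqF.
apply: (@le_trans _ _ ((1 + n%:R^-1) *
    Ex p (n * m + m) (fun w => resid m n (take (n * m) w) ^+ 2)
    + (1 + n%:R) * Ex p (n * m + m) (fun w => defect (n * m) w ^+ 2))); last first.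
  rewrite (Ex_take p_sum1 _ _ (fun w => resid m n w ^+ 2)).
  by apply: lerD; apply: ler_wpM2l => //; rewrite addr_ge0// ?invr_ge0 ltW.
rewrite -!ExZ -ExD; apply: le_Ex => // w _.
set x := resid _ _ _; set y := defect _ _.
rewrite -subr_ge0.
have -> : (1 + n%:R^-1) * x ^+ 2 + (1 + n%:R) * y ^+ 2 - (x + y) ^+ 2 =
    n%:R^-1 * (x - n%:R * y) ^+ 2 by field; rewrite gt_eqF.
by rewrite mulr_ge0 ?sqr_ge0// invr_ge0 ltW.
Qed.

(** Since [mart] has mean zero, the quantity being squared is the mean of [resid]. *)
Lemma xmean_blocks N K : (0 < K)%N ->
  (xmean (N * K ^ 4) - N%:R * xmean (K ^ 4)) ^+ 2 <=
  N%:R ^+ 2 * (defect_cst * K%:R ^+ 7).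
Proof.
move=> K0; apply: le_trans (Ex_resid_sqr N K0).
apply: le_trans (Ex_sqr_le p_ge0 p_sum1 _ _).
by rewrite !ExB Ex_mart Ex_cst// subr0.
Qed.

(** With [K] blocks of length [K^4] both parts are of order [K^9]: [K (K^4)^2] for [mart] and
    [K^2 K^7] for [resid]. Relative to the squared length [K^10] this is a gain of [1 / K]. *)
Lemma xpos_block_variance K : (0 < K)%N ->
  Ex p (K * K ^ 4) (fun w => ((xpos w)%:~R - K%:R * xmean (K ^ 4)) ^+ 2) <=
  (2 + 2 * defect_cst) * K%:R ^+ 9.
Proof.
move=> K0; have h1 := Ex_mart_sqr (K ^ 4) K; have h2 := Ex_resid_sqr K K0.
apply: (@le_trans _ _ (2 * Ex p (K * K ^ 4) (fun w => mart (K ^ 4) K w ^+ 2)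
   + 2 * Ex p (K * K ^ 4) (fun w => resid (K ^ 4) K w ^+ 2))).
  set a := K%:R * _.
  rewrite -!ExZ -ExD; apply: le_Ex => // w _.
  set x := mart _ _ _; set y := resid _ _ _.
  have -> : (xpos w)%:~R - a = x + y by rewrite /y /resid -/x -/a; ring.
  by have := sqr_ge0 (x - y); nra.
apply: le_trans (lerD (ler_wpM2l _ h1) (ler_wpM2l _ h2)) _ => //.
by apply: eq_ler; rewrite natrX; ring.
Qed.

End Variance.

(** * The range of the projected walk *)

Section Range.
Context {R : realFieldType} {d : nat} (beta mu : R).
Local Notation letter := (@letter d).
Local Notation V := 'rV[int]_d.+1.
Local Notation p := (@weight R d beta mu).
Hypothesis p_ge0 : forall a, 0 <= p a.
Hypothesis d8 : (8 <= d)%N.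

Definition nsq (x : V) : R := \sum_(i | i != ord0) (x ord0 i)%:~R ^+ 2.

Lemma nsq_ge0 x : 0 <= nsq x.
Proof. by apply: sumr_ge0 => i _; exact: sqr_ge0. Qed.

Lemma nsq0 : nsq 0 = 0.
Proof. by apply: big1 => i _; rewrite mxE expr2 mul0r. Qed.

Lemma coord_le_nsq (x : V) i : i != ord0 -> (x ord0 i)%:~R ^+ 2 <= nsq x.
Proof.
move=> i0; rewrite /nsq (bigD1 i)//= lerDl.
by apply: sumr_ge0 => j _; exact: sqr_ge0.
Qed.

Lemma nsqD_pmove (x : V) (a : letter) : a.1.1 != ord0 ->
  nsq (x + pmove a) = nsq x + 1 + 2 * (sg a.1.2)%:~R * (x ord0 a.1.1)%:~R.
Proof.
move=> a0; rewrite /nsq (bigD1 a.1.1)//= [in RHS](bigD1 a.1.1)//=.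
rewrite mxE pmove_coord a0 eqxx/= rmorphD/=.
rewrite (eq_bigr (fun i => (x ord0 i)%:~R ^+ 2)); last first.
  by move=> i /andP[_ ia]; rewrite mxE pmove_coord (negbTE ia) andbF addr0.
by case: a.1.2; rewrite /sg ?rmorphN/=; ring.
Qed.

(** Serves as an upper bound for the probability of ever hitting the origin from [x]; it equals 1 at
    the origin. *)
Definition escape (x : V) : R := (1 + 2 * nsq x)^-1.

(** With [z] the coordinate of [x] along [c], the two neighbours have denominators [s + 4 z] and
    [s - 4 z]. Their product [s^2 - 16 z^2] is at least [s^2 - 8 s + 24], which is common to all
    axes, so that only [z^2] is left to sum, giving [nsq x]. *)
Lemma escape_axis (x : V) (s : R) (c : 'I_d.+1) :
  s = 3 + 2 * nsq x -> c != ord0 ->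
  ((p (c, true, true) * escape (x + pmove (c, true, true))
    + p (c, true, false) * escape (x + pmove (c, true, false)))
  + (p (c, false, true) * escape (x + pmove (c, false, true))
    + p (c, false, false) * escape (x + pmove (c, false, false))))
  <= (s^-1 + 16 * (x ord0 c)%:~R ^+ 2 / (s * (s ^+ 2 - 8 * s + 24))) / d.+1%:R.
Proof.
move=> sE c0; rewrite /escape !nsqD_pmove//= /weight/= (negbTE c0).
set z : R := (x ord0 c)%:~R.
have zQ : z ^+ 2 <= nsq x by exact: coord_le_nsq.
have Q0 := nsq_ge0 x.
have s3 : 3 <= s by rewrite sE; lra.
have z2s : 2 * z ^+ 2 <= s - 3 by rewrite sE; lra.
have b0 : 0 < s ^+ 2 - 8 * s + 24 by have := sqr_ge0 (s - 4); nra.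
have bz : s ^+ 2 - 8 * s + 24 <= (s - 4 * z) * (s + 4 * z) by nra.
have [p0 m0] : 0 < s + 4 * z /\ 0 < s - 4 * z.
  have pm0 := lt_le_trans b0 bz.
  by split; rewrite ltNge; apply/negP => h; move: pm0; rewrite ltNge => /negP; apply;
    [rewrite mulr_ge0_le0|rewrite mulr_le0_ge0] => //; lra.
have -> : 1 + 2 * (nsq x + 1 + 2 * 1%:~R * z) = s + 4 * z by rewrite sE; ring.
have -> : 1 + 2 * (nsq x + 1 + 2 * (-1)%:~R * z) = s - 4 * z by rewrite sE; ring.
have d0 : 0 < d.+1%:R :> R by rewrite ltr0n.
rewrite -subr_ge0.
set b := s ^+ 2 - 8 * s + 24 in b0 bz *.
have -> : (s^-1 + 16 * z ^+ 2 / (s * b)) / d.+1%:R -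
    (1 / 4 / d.+1%:R / (s + 4 * z) + 1 / 4 / d.+1%:R / (s + 4 * z) +
    (1 / 4 / d.+1%:R / (s - 4 * z) + 1 / 4 / d.+1%:R / (s - 4 * z))) =
    16 * z ^+ 2 * ((s - 4 * z) * (s + 4 * z) - b) /
    (s * b * ((s - 4 * z) * (s + 4 * z)) * d.+1%:R).
  field; rewrite !gt_eqF//=; lra.
have s0 : 0 < s by lra.
apply: divr_ge0; last by rewrite ltW// !mulr_gt0.
by rewrite mulr_ge0 ?subr_ge0// mulr_ge0 ?sqr_ge0.
Qed.

(* [escape] is superharmonic for the projected walk because [d >= 8]. *)
Lemma escape_superharmonic x : \sum_a p a * escape (x + pmove a) <= escape x.
Proof.
have Q0 := nsq_ge0 x.
rewrite sum_letter (bigD1 ord0)//=.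
have pm0 b b' : pmove (ord0, b, b') = 0 :> V by apply/eqP; rewrite pmove_eq0.
rewrite !pm0 addr0 weight_axis_mul.
apply: le_trans (lerD (lexx _) (ler_sum _ (fun c c0 => escape_axis (erefl _) c0))) _.
rewrite -mulr_suml big_split/= sumr_const cardC1 card_ord/=.
rewrite -mulr_suml -mulr_sumr -/(nsq x).
set Q := nsq x in Q0 *; set s := 3 + 2 * Q.
have s3 : 3 <= s by rewrite /s; lra.
have b0 : 0 < s ^+ 2 - 8 * s + 24 by have := sqr_ge0 (s - 4); nra.
have dR : 8 <= d%:R :> R by rewrite ler_nat.
rewrite /escape -/Q (_ : 1 + 2 * Q = s - 2); last by rewrite /s; ring.
rewrite -subr_ge0 -[d.+1%:R]natr1 -[s^-1 *+ d]mulr_natr.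
have -> : 16 * Q = 8 * (s - 3) by rewrite /s; ring.
set b := s ^+ 2 - 8 * s + 24 in b0 *.
have -> : (s - 2)^-1 - ((d%:R + 1)^-1 * (s - 2)^-1 +
    (s^-1 * d%:R + 8 * (s - 3) / (s * b)) / (d%:R + 1)) =
    (2 * d%:R * b - 8 * (s - 3) * (s - 2)) / (s * b * (s - 2) * (d%:R + 1)).
  field; rewrite !gt_eqF//=; lra.
apply: divr_ge0; last by rewrite !mulr_ge0//; lra.
(* The hypothesis [8 <= d] enters here; what remains is [s^2 - 11 s + 42 >= 0], of negative
   discriminant. *)
have db : 8 * b <= d%:R * b by rewrite ler_wpM2r// ltW.
have bs : 8 * (s - 3) * (s - 2) <= 16 * b.
  by rewrite /b; have := sqr_ge0 (s - 11 / 2); nra.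
rewrite -mulrA; move: (d%:R * b) db => y; lra.
Qed.

(* In chronological order, so that [undup] keeps the last visits: a site is
   visited for the last time with probability at least [16 / 27]. *)
Fixpoint plist (x : V) (w : seq letter) : seq V :=
  x :: if w is a :: w' then plist (x + pmove a) w' else [::].

Lemma plist_shift x y z w : (z + x \in plist (z + y) w) = (x \in plist y w).
Proof.
elim: w y => [|a w IHw] y /=; rewrite !inE (inj_eq (addrI z))//.
by rewrite -addrA IHw.
Qed.

(** Optional stopping at the origin: away from it superharmonicity carries the induction, and at it
    the bound is 1. *)
Lemma Ex_hit_le k x : Ex p k (fun w => (0 \in plist x w)%:R) <= escape x.
Proof.
have [->|x0] := eqVneq x 0.
  rewrite /escape nsq0 mulr0 addr0 invr1.
  by apply: Ex_le_cst => //; [exact: weight_sum1|move=> w _; case: (_ \in _)].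
elim: k x x0 => [|k IHk] x x0.
  rewrite /= inE eq_sym (negbTE x0) invr_ge0 addr_ge0// mulr_ge0//.
  exact: nsq_ge0.
rewrite ExS; apply: le_trans (escape_superharmonic x); apply: ler_sum => a _.
rewrite ler_wpM2l//=.
rewrite (eq_Ex _ (g := fun w => (0 \in plist (x + pmove a) w)%:R)); last first.
  by move=> w _; rewrite inE eq_sym (negbTE x0).
have [->|] := eqVneq (x + pmove a) 0; last exact: IHk.
rewrite /escape nsq0 mulr0 addr0 invr1.
by apply: Ex_le_cst => //; [exact: weight_sum1|move=> w _; case: (_ \in _)].
Qed.

(** The first letter leaves the projection at 0 with probability [1 / (d + 1)] and otherwise leads
    to a unit vector, where [escape] is 1/3. The total [(d + 3) / (3 (d + 1))] equals 11/27 at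
    [d = 8] and decreases in [d]. *)
Lemma return_le k : \sum_a p a * Ex p k (fun w => (0 \in plist (pmove a) w)%:R)
  <= 11 / 27.
Proof.
apply: (@le_trans _ _ (\sum_a p a * escape (pmove a))).
  by apply: ler_sum => a _; rewrite ler_wpM2l// Ex_hit_le.
rewrite sum_letter (bigD1 ord0)//=.
have pm0 b b' : pmove (ord0, b, b') = 0 :> V by apply/eqP; rewrite pmove_eq0.
rewrite !pm0 weight_axis_mul.
rewrite (eq_bigr (fun=> (3 * d.+1%:R)^-1)); last first.
  move=> c c0; have pmc b b' : escape (pmove (c, b, b')) = 3^-1.
    rewrite -[pmove _]add0r /escape nsqD_pmove//= nsq0 mxE mulr0 addr0.
    by congr (_^-1); ring.
  by rewrite !pmc weight_axis_mul invfM mulrC.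
rewrite sumr_const cardC1 card_ord/= /escape nsq0 mulr0 addr0 invr1 mulr1.
have dR : 8 <= d%:R :> R by rewrite ler_nat.
rewrite -[X in _ + X]mulr_natr -[d.+1%:R]natr1 -subr_ge0.
have -> : 11 / 27 - ((d%:R + 1)^-1 + (3 * (d%:R + 1))^-1 * d%:R) =
    (6 * d%:R - 48) / (81 * (d%:R + 1)) :> R.
  by field; rewrite gt_eqF//; lra.
by apply: divr_ge0; lra.
Qed.

Lemma Ex_plist_undup k x :
  k.+1%:R * (16 / 27) <= Ex p k (fun w => (size (undup (plist x w)))%:R).
Proof.
elim: k x => [|k IHk] x; first by rewrite /= mul1r; lra.
rewrite ExS.
rewrite (eq_bigr (fun a => p a * (1 - Ex p k (fun w => (0 \in plist (pmove a) w)%:R))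
    + p a * Ex p k (fun w => (size (undup (plist (x + pmove a) w)))%:R))); last first.
  move=> a _; rewrite -mulrDr; congr (_ * _).
  rewrite -[X in X - _](Ex_cst (weight_sum1 (d := d) beta mu) k) -ExB -ExD.
  apply: eq_Ex => w _ /=; rewrite -{1}[x]addr0 plist_shift.
  by case: (0 \in _) => /=; rewrite ?subrr ?add0r// subr0 nat1r.
rewrite big_split/=.
have h2 : k.+1%:R * (16 / 27) <= \sum_a p a *
    Ex p k (fun w => (size (undup (plist (x + pmove a) w)))%:R).
  rewrite -[leLHS]mul1r -[X in X * _ <= _](weight_sum1 (d := d) beta mu) mulr_suml.
  by apply: ler_sum => a _; rewrite ler_wpM2l.
have h1 : 16 / 27 <= \sum_a p a * (1 - Ex p k (fun w => (0 \in plist (pmove a) w)%:R)).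
  rewrite (eq_bigr (fun a => p a - p a * Ex p k (fun w => (0 \in plist (pmove a) w)%:R))).
    by rewrite sumrB weight_sum1; have := return_le k; lra.
  by move=> a _; rewrite mulrBr mulr1.
by rewrite -natr1 mulrDl mul1r addrC lerD.
Qed.

Lemma plist_sub_trace w : {subset plist 0 w <= [seq proj x | x <- trace w]}.
Proof.
elim/last_ind: w => [|w a IHw]; first by rewrite /= proj0.
have -> : plist 0 (rcons w a) = rcons (plist 0 w) (psum (rcons w a)).
  rewrite -[psum _]add0r; move: 0; elim: w {IHw} => [|b w IHw] x /=.
    by rewrite psum_cons psum_nil addr0.
  by rewrite IHw psum_cons addrA.
move=> y; rewrite mem_rcons inE trace_rcons /= inE => /orP[/eqP->|/IHw->].
  by rewrite -pos_rcons proj_pos eqxx.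
by rewrite orbT.
Qed.

(** Projection can only merge sites, so the range of the projected walk bounds the range of the walk
    from below. *)
Lemma size_undup_plist w : (size (undup (plist 0 w)) <= size (undup (trace w)))%N.
Proof.
rewrite -(size_map (@proj d) (undup (trace w))); apply: uniq_leq_size.
  exact: undup_uniq.
move=> y; rewrite mem_undup => /plist_sub_trace/mapP[x xw ->].
by apply: map_f; rewrite mem_undup.
Qed.

Lemma drift vis : \sum_a p a * ((move vis a : V) ord0 ord0)%:~R =
  (if vis then - mu else beta) / d.+1%:R.
Proof.
rewrite sum_letter (bigD1 ord0)//= [X in _ + X]big1 ?addr0; last first.
  move=> c c0; have mv b b' : (move vis (c, b, b') : V) ord0 ord0 = 0.
    by rewrite !mxE /= [ord0 == c]eq_sym (negbTE c0) mulr0.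
  by rewrite !mv !mulr0 !addr0.
rewrite /weight !mxE/= !eqxx/= andbT.
by case: vis; rewrite /sg /= !mulr1 ?rmorphN/=; field; rewrite nat1r pnatr_eq0.
Qed.

(** Sums the mean step, [beta / (d + 1)] from a new site and [- mu / (d + 1)] from an old one. The
    first [m + 1] steps start from the [m + 1] positions in the trace of [m] letters, whence the
    shift of index. *)
Lemma xmean_undup m : xmean p m.+1 =
  ((beta + mu) * Ex p m (fun w => (size (undup (trace w)))%:R) - m.+1%:R * mu)
  / d.+1%:R.
Proof.
have p1 := weight_sum1 (d := d) beta mu.
have step n : xmean p n.+1 = xmean p n +
    ((beta + mu) * Ex p n (fun w => (fresh w)%:R) - mu) / d.+1%:R.
  rewrite /xmean Ex_rcons -ExZ -[X in (_ - X) / _](Ex_cst p1 n) -ExB -ExZr -ExD.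
  apply: eq_Ex => w _.
  rewrite (eq_bigr (fun a => p a * (xpos w)%:~R +
      p a * ((move (~~ fresh w) a : V) ord0 ord0)%:~R)); last first.
    by move=> a _; rewrite /xpos pos_rcons mxE rmorphD mulrDr.
  rewrite big_split/= -mulr_suml p1 mul1r drift; congr (_ + _ / _).
  by case: fresh => /=; rewrite ?mulr1 ?mulr0; ring.
elim: m => [|m IHm].
  rewrite step /xmean /= xpos_nil.
  by rewrite add0r !mul1r.
rewrite step IHm -mulrDl; congr (_ / _).
have -> : Ex p m.+1 (fun w => (size (undup (trace w)))%:R) =
    Ex p m (fun w => (size (undup (trace w)))%:R) + Ex p m.+1 (fun w => (fresh w)%:R).
  rewrite -[m.+1]addn1 -(Ex_take p1 m 1) -ExD; apply: eq_Ex => w.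
  case/lastP: w => [|w a]; first by rewrite addn1.
  rewrite size_rcons addn1 => -[<-]; rewrite -cats1 take_size_cat// cats1.
  rewrite (trace_head (rcons w a)) /= /fresh (trace_rcons w a) /=.
  by case: ifP => _ /=; rewrite ?addr0// natr1.
by rewrite -[m.+2%:R]natr1; ring.
Qed.

Lemma xmean_ge m : 0 <= beta -> 0 <= mu ->
  m%:R * ((16 * beta - 11 * mu) / (27 * d.+1%:R)) <= xmean p m.
Proof.
move=> b0 m0; case: m => [|m]; first by rewrite mul0r /xmean /= xpos_nil.
rewrite xmean_undup.
have h : m.+1%:R * (16 / 27) <= Ex p m (fun w => (size (undup (trace w)))%:R).
  apply: le_trans (Ex_plist_undup m 0) _; apply: le_Ex => // w _.
  by rewrite ler_nat size_undup_plist.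
have d0 : 0 < d.+1%:R :> R by rewrite ltr0n.
rewrite ler_pdivlMr//.
have -> : m.+1%:R * ((16 * beta - 11 * mu) / (27 * d.+1%:R)) * d.+1%:R =
  (beta + mu) * (m.+1%:R * (16 / 27)) - m.+1%:R * mu.
  by field; rewrite nat1r pnatr_eq0.
by rewrite lerB// ler_wpM2l// addr_ge0.
Qed.

End Range.

Local Open Scope classical_set_scope.

(** * From finite words to the process *)

Section Interpolation.
Context {R : realType}.

(** By convexity the power lies below its chord on the unit interval. *)
Lemma exp1D_le (x : R) k : 0 <= x <= 1 -> (1 + x) ^+ k <= 1 + (2 ^+ k - 1) * x.
Proof.
move=> /andP[x0 x1]; elim: k => [|k IHk].
  by rewrite !expr0 subrr mul0r addr0.
rewrite exprS; apply: le_trans (ler_wpM2l _ IHk) _; first by rewrite addr_ge0.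
rewrite exprS; have : 1 <= 2 ^+ k :> R by rewrite exprn_ege1// ler1n.
set y : R := 2 ^+ k => y1.
have : 0 <= (y - 1) * x * (1 - x) by rewrite !mulr_ge0// subr_ge0.
lra.
Qed.

Lemma lipschitz_steps (x : nat -> R) : (forall n, `|x n.+1 - x n| <= 1) ->
  forall m n, (m <= n)%N -> `|x n - x m| <= n%:R - m%:R.
Proof.
move=> x1 m n mn; rewrite -(subnKC mn); elim: (n - m)%N => [|k IHk].
  by rewrite addn0 !subrr normr0.
rewrite addnS -natr1.
have -> : x (m + k).+1 - x m = (x (m + k).+1 - x (m + k)%N) + (x (m + k)%N - x m).
  by ring.
apply: le_trans (ler_normD _ _) _.
by rewrite addrAC [leRHS]addrC; apply: lerD.
Qed.

Lemma between_powers k n : (0 < n)%N -> (0 < k)%N ->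
  exists j, (j.+1 ^ k <= n < j.+2 ^ k)%N.
Proof.
move=> n0 k0; have ex : exists j, (j.+1 ^ k <= n)%N by exists 0%N; rewrite exp1n.
have ub j : (j.+1 ^ k <= n)%N -> (j <= n)%N.
  apply: leq_trans; apply: leq_trans (leqnSn _) _.
  by rewrite -{1}[j.+1]expn1 leq_pexp2l.
case: (ex_maxnP ex ub) => j jn jmax; exists j; rewrite jn /= ltnNge.
by apply/negP => /jmax; rewrite ltnn.
Qed.

(** Consecutive [k]-th powers differ by at most [2^k / (j + 1)] times the smaller one, so a path
    with steps at most 1 cannot change its normalized value much between them. *)
Lemma cvg_interpolate (k : nat) (x a : nat -> R) (l : R) : (0 < k)%N ->
    (forall n, `|x n.+1 - x n| <= 1) -> (forall n, `|x n| <= n%:R) ->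
    a @ \oo --> l ->
    (\forall j \near \oo, `|x (j.+1 ^ k)%N / (j.+1 ^ k)%:R - a j| <= j.+1%:R^-1) ->
  (fun n => x n / n%:R) @ \oo --> l.
Proof.
move=> k0 x1 xn al near_a; apply/cvgrPdist_le => e e0.
have [N1 _ hN1] : \forall j \near \oo, `|l - a j| <= e / 3.
  by move/cvgrPdist_le : al; apply; rewrite divr_gt0.
have [N2 _ hN2] := near_a.
have [N3 hN3] : exists N3 : nat, (2 ^+ k * 2 + 1) * 3 / e <= N3%:R.
  exists (Num.truncn ((2 ^+ k * 2 + 1) * 3 / e)).+1; apply: ltW; exact: truncnS_gt.
pose N := maxn N1 (maxn N2 N3).
exists (N.+1 ^ k)%N => //= n /= Nn.
have n0 : (0 < n)%N by apply: leq_trans Nn; rewrite expn_gt0.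
have [j /andP[jn nj]] := between_powers n0 k0.
have Nj : (N <= j)%N.
  rewrite -ltnS -[(N < j.+1)%N]ltnS -(ltn_exp2r _ _ k0); exact: leq_ltn_trans nj.
have h1 := hN1 j (leq_trans (leq_maxl _ _) Nj).
have h2 := hN2 j (leq_trans (leq_trans (leq_maxl _ _) (leq_maxr _ _)) Nj).
set m := (j.+1 ^ k)%N in jn h2.
have m0 : 0 < m%:R :> R by rewrite ltr0n expn_gt0.
have n0R : 0 < n%:R :> R by rewrite ltr0n.
have j0 : 0 < j.+1%:R :> R by rewrite ltr0n.
have mn : m%:R <= n%:R :> R by rewrite ler_nat.
have gap : n%:R - m%:R <= m%:R * (2 ^+ k / j.+1%:R) :> R.
  have : n%:R <= (j.+2 ^ k)%:R :> R by rewrite ler_nat ltnW.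
  have -> : (j.+2 ^ k)%:R = m%:R * (1 + j.+1%:R^-1) ^+ k :> R.
    rewrite /m !natrX -exprMn; congr (_ ^+ k).
    by rewrite mulrDr mulr1 divff ?gt_eqF// natr1.
  have := @exp1D_le j.+1%:R^-1 k; rewrite invr_ge0 ler0n invf_le1// ler1n => /(_ isT).
  move=> /(ler_wpM2l (ltW m0)) h3 /le_trans/(_ h3).
  have : 0 <= m%:R / j.+1%:R :> R by rewrite divr_ge0// ltW.
  have -> : m%:R * (1 + (2 ^+ k - 1) / j.+1%:R) =
      m%:R + m%:R * (2 ^+ k / j.+1%:R) - m%:R / j.+1%:R :> R by ring.
  by set z := m%:R * (2 ^+ k / _); set y := m%:R / _; lra.
have xd := lipschitz_steps x1 jn.
have h3 : `|x m / m%:R - x n / n%:R| <= 2 * (2 ^+ k / j.+1%:R).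
  (* One term for the increment of [x], one for the change of the normalization; each is at most
     [2^k / (j + 1)]. *)
  have -> : x m / m%:R - x n / n%:R =
      (x m - x n) / n%:R + x m * (n%:R - m%:R) / (m%:R * n%:R).
    by field; rewrite !gt_eqF.
  apply: le_trans (ler_normD _ _) _; rewrite [leRHS]mulr_natl mulr2n; apply: lerD.
    rewrite normrM normfV (gtr0_norm n0R) distrC ler_pdivrMr//.
    apply: le_trans xd _; apply: le_trans gap _.
    by rewrite mulrC ler_wpM2l// divr_ge0// exprn_ge0.
  rewrite !normrM normfV [`|n%:R - _|]ger0_norm ?subr_ge0//.
  rewrite (gtr0_norm (mulr_gt0 m0 n0R)) ler_pdivrMr ?mulr_gt0//.
  apply: (@le_trans _ _ (m%:R * (m%:R * (2 ^+ k / j.+1%:R)))).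
    by apply: ler_pM => //; rewrite subr_ge0.
  rewrite [leRHS]mulrCA ler_wpM2l ?(ltW m0)// [leLHS]mulrC.
  by rewrite ler_wpM2l// divr_ge0// exprn_ge0.
have h4 : (2 ^+ k * 2 + 1) / j.+1%:R <= e / 3.
  have /(ler_wpM2r (ltW e0)) : N3%:R <= j.+1%:R :> R.
    rewrite ler_nat; apply: leqW; apply: leq_trans Nj.
    by rewrite /N !leq_max leqnn !orbT.
  move: hN3; rewrite !ler_pdivrMr// => hN3 /(le_trans hN3) h4.
  by move: (_ + 1) h4 => z; lra.
have -> : l - x n / n%:R = (l - a j) + (a j - x m / m%:R) + (x m / m%:R - x n / n%:R).
  by ring.
apply: le_trans (ler_normD _ _) _; apply: le_trans (lerD (ler_normD _ _) (lexx _)) _.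
move: h4; rewrite mulrDl mul1r [2 ^+ k * 2]mulrC -mulrA.
move: h2; rewrite distrC; move: h1 h3.
move: `|l - a j| `|a j - _| `|_ - x n / _| => u v w.
by set y := 2 ^+ k / _; set z := j.+1%:R^-1; lra.
Qed.

Lemma cvg_cauchy_rate (a : nat -> R) (D : R) : 0 <= D ->
    (forall i j, (a i - a j) ^+ 2 <= D / i.+1%:R + D / j.+1%:R) ->
  exists l : R, a @ \oo --> l.
Proof.
move=> D0 aD; suff : cvgn a by move/cvg_ex => [l al]; exists l.
apply/cauchy_cvgP/cauchy_exP => e e0.
have [N hN] : exists N : nat, 2 * D / e ^+ 2 < N%:R.
  by exists (Num.truncn (2 * D / e ^+ 2)).+1; exact: truncnS_gt.
exists (a N); exists N => //= n /= Nn; rewrite -ball_normE /=.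
have e2 : 0 < e ^+ 2 by rewrite exprn_gt0.
have N1 : 0 < N.+1%:R :> R by rewrite ltr0n.
have : `|a N - a n| ^+ 2 < e ^+ 2.
  rewrite -normrX ger0_norm ?sqr_ge0//; apply: le_lt_trans (aD N n) _.
  apply: (@le_lt_trans _ _ (2 * D / N.+1%:R)).
    rewrite -mulrA mulr_natl mulr2n lerD2l ler_wpM2l// lef_pV2 ?posrE ?ltr0n//.
    by rewrite ler_nat ltnS.
  rewrite ltr_pdivrMr// [ltRHS]mulrC -ltr_pdivrMr//; apply: lt_trans hN _.
  by rewrite ltr_nat.
by rewrite ltr_pXn2r ?nnegrE// ltW.
Qed.

End Interpolation.

(** * Law of one step *)

Section StepLaw.
Context {R : realType} {d : nat} (beta mu : R).
Local Notation letter := (@letter d).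
Local Notation V := 'rV[int]_d.+1.
Local Notation p := (@weight R d beta mu).

Definition step_weight (vis : bool) (x : V) : R :=
  \sum_a p a * (move vis a == x)%:R.

Lemma unit_vectorP (x : V) :
  reflect (exists c s, x = sg s *: delta_mx ord0 c) (unit_vector x).
Proof.
apply: (iffP eqP) => [x1|[c [s ->]]]; last first.
  rewrite /dot (bigD1 c)//= big1 => [|j jc]; last first.
    by rewrite !mxE (negbTE jc) andbF !mulr0.
  by rewrite !mxE !eqxx addr0; case: s.
have sq0 j : 0 <= x ord0 j * x ord0 j by rewrite -expr2 sqr_ge0.
have [c xc] : exists c, x ord0 c != 0.
  apply/existsP; apply: contraPT x1 => /existsPn x0.
  rewrite /dot big1// => j _; have := x0 j; rewrite negbK => /eqP->.
  by rewrite mul0r.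
move: x1; rewrite /dot (bigD1 c)//=.
set S := \sum_(_ | _) _; have S0 : 0 <= S by apply: sumr_ge0.
move=> h; have c1 : 0 < x ord0 c * x ord0 c by rewrite lt0r sq0 mulf_neq0.
have Sz : S = 0 by move: h c1 S0; move: (x _ _ * _) S => y z; lia.
have xc1 : x ord0 c = 1 \/ x ord0 c = -1 by move: h; rewrite Sz; move: (x _ _) => y; nia.
exists c, (x ord0 c == 1); apply/rowP => j; rewrite !mxE eqxx /=.
have [->|jc] := eqVneq j c; first by case: xc1 => ->.
rewrite mulr0; apply/eqP; rewrite -[_ == _]orbb -mulf_eq0.
move/eqP: Sz; rewrite psumr_eq0// => /allP/(_ j); rewrite mem_index_enum => /(_ isT).
by rewrite jc.
Qed.

Lemma move_unit vis a : unit_vector (move vis a : V).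
Proof. by apply/unit_vectorP; exists a.1.1; eexists. Qed.

Lemma delta_sg_inj c c' s s' :
  (sg s *: delta_mx ord0 c == sg s' *: delta_mx ord0 c' :> V)
  = (c == c') && (s == s').
Proof.
apply/eqP/andP => [|[/eqP-> /eqP->]//].
move/rowP/(_ c); rewrite !mxE !eqxx /=; case: (c == c'); rewrite ?mulr1 ?mulr0.
  by case: s; case: s'.
by case: s.
Qed.

(** Summing out the sign that [move] does not read recovers the prescribed step probabilities, so
    words of letters drive the walk for either value of [vis]. *)
Lemma step_weightE vis (x : V) : step_weight vis x =
  if unit_vector x then
    if vis then (1 - (dot (e1 d.+1) x)%:~R * mu) / (2 * d.+1)%:R
    else (1 + (dot (e1 d.+1) x)%:~R * beta) / (2 * d.+1)%:R
  else 0.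
Proof.
rewrite /step_weight; case: ifPn => [/unit_vectorP[c [s ->]]|xu]; last first.
  rewrite big1// => a _; case: eqP => [e|_]; last by rewrite mulr0.
  by rewrite -e move_unit in xu.
rewrite dot_e1 /coord1 !mxE eqxx /= sum_letter (bigD1 c)//=.
rewrite [X in _ + X]big1 ?addr0; last first.
  by move=> c' c'c; rewrite /move/= !delta_sg_inj (negbTE c'c) !mulr0 !addr0.
rewrite /move/= !delta_sg_inj eqxx /= /weight /= natrM [ord0 == c]eq_sym.
have [c0|c0] := eqVneq c ord0; rewrite ?andbT ?andbF /=.
  by case: vis; case: s; rewrite /sg /= ?mulr1 ?rmorphN /=; field;
    rewrite nat1r pnatr_eq0.
by rewrite mulr0 !mul0r subr0 addr0; case: vis; case: s => /=; field;
  rewrite nat1r pnatr_eq0.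
Qed.

End StepLaw.

(** * Law of finite paths *)

Section PathLaw.
Context {R : realType} {d : nat} (beta mu : R).
Local Notation letter := (@letter d).
Local Notation V := 'rV[int]_d.+1.
Local Notation p := (@weight R d beta mu).
Hypothesis beta01 : 0 <= beta <= 1.
Hypothesis mu01 : 0 <= mu <= 1.

Lemma weight_ge0 (a : letter) : 0 <= p a.
Proof.
have [b0 b1] := andP beta01; have [m0 m1] := andP mu01.
rewrite /weight; apply: divr_ge0 => //; case: ifP => // _.
by case: a.1.2; case: a.2; rewrite /sg /= ?rmorphN /=; apply: mulr_ge0; lra.
Qed.

Context {disp : measure_display} {T : measurableType disp} (P : probability T R)
  (omega : nat -> T -> 'rV[int]_d.+1).
Hypothesis erwd : is_ERWD beta mu P omega.

(** Latest position first, the order of [trace], so that the process and the words are compared as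
    lists. *)
Fixpoint rtrace (eta : nat -> V) (n : nat) : seq V :=
  if n is n'.+1 then eta n :: rtrace eta n' else [:: eta 0%N].

Lemma head_rtrace eta n : head 0 (rtrace eta n) = eta n.
Proof. by case: n. Qed.

Lemma size_rtrace eta n : size (rtrace eta n) = n.+1.
Proof. by elim: n => //= n ->. Qed.

Lemma size_trace (w : seq letter) : size (trace w) = (size w).+1.
Proof.
by elim/last_ind: w => // w a IHw; rewrite trace_rcons /= IHw size_rcons.
Qed.

Lemma mem_behead_rtrace eta n :
  (eta n \in behead (rtrace eta n)) = visited_before eta n.
Proof.
have mem m x : (x \in rtrace eta m) = [exists k : 'I_m.+1, eta k == x].
  elim: m => [|m IHm].
    rewrite inE; apply/eqP/existsP => [->|[k /eqP <-]]; first by exists ord0.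
    by rewrite ord1.
  rewrite /= inE IHm; apply/orP/existsP => [[/eqP->|/existsP[k kx]]|[k /eqP <-]].
  - by exists ord_max.
  - by exists (widen_ord (leqnSn _) k).
  - have [km|mk] := ltnP k m.+1; last first.
      by left; rewrite (_ : k = m.+1 :> nat)//; apply/eqP; rewrite eqn_leq mk -ltnS ltn_ord.
    by right; apply/existsP; exists (Ordinal km).
case: n => [|n] /=; last exact: mem.
by rewrite in_nil; apply/esym/existsP => -[[]].
Qed.

Lemma rtrace_inj eta eta' n : rtrace eta n = rtrace eta' n <->
  (forall k, (k <= n)%N -> eta k = eta' k).
Proof.
elim: n => [|n IHn] /=; split.
- by move=> [e0] k; rewrite leqn0 => /eqP->.
- by move=> ->.
- move=> [en /IHn ek] k; rewrite leq_eqVlt => /orP[/eqP->//|]; exact: ek.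
- by move=> ek; rewrite ek//; congr (_ :: _); apply/IHn => k kn; rewrite ek// ltnW.
Qed.

Lemma measurable_rtrace n h : measurable [set t | rtrace (omega^~ t) n = h].
Proof.
elim: n h => [|n IHn] [|x h] /=.
- by rewrite (_ : [set _ | _] = set0)//; apply/seteqP; split.
- have [->|h0] := eqVneq h [::].
    rewrite (_ : [set _ | _] = omega 0%N @^-1` [set x]); first exact: (ERWD_measurable erwd).
    by apply/seteqP; split => t /= => [[]|->].
  rewrite (_ : [set _ | _] = set0)//; apply/seteqP; split => t //= -[_ e].
  by rewrite -e in h0.
- by rewrite (_ : [set _ | _] = set0)//; apply/seteqP; split.
- rewrite (_ : [set _ | _] =
    (omega n.+1 @^-1` [set x]) `&` [set t | rtrace (omega^~ t) n = h]).
    by apply: measurableI; [exact: (ERWD_measurable erwd)|exact: IHn].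
  by apply/seteqP; split => t /= => [[-> ->]|[-> ->]].
Qed.

(** Lists of sites form a countable type, so every event on a finite path is a countable union of
    measurable fibres. *)
Lemma measurable_path n (Q : set (seq V)) :
  measurable [set t | Q (rtrace (omega^~ t) n)].
Proof.
rewrite (_ : [set _ | _] = \bigcup_h
  (if `[< Q h >] then [set t | rtrace (omega^~ t) n = h] else set0)).
  apply: countable_bigcupT_measurable => [|h]; first exact: countableP.
  by case: asboolP => // _; exact: measurable_rtrace.
apply/seteqP; split => t /=.
  by move=> Qt; exists (rtrace (omega^~ t) n) => //; rewrite asboolT.
by move=> [h _]; case: asboolP => // Qh /= ->.
Qed.

(** Induction on the length: appending a step multiplies both sides by the same [step_prob]. *)
Lemma history_law eta n : P (history omega eta n) =
  (Ex p n (fun w => (trace w == rtrace eta n)%:R))%:E.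
Proof.
have hist k : history omega eta k = [set t | rtrace (omega^~ t) k = rtrace eta k].
  by apply/seteqP; split => t /= /rtrace_inj.
have mh k : measurable (history omega eta k).
  by rewrite hist; exact: measurable_rtrace.
elim: n => [|n IHn].
  rewrite hist /= eqseq_cons andbT; have [e0|e0] := eqVneq 0 (eta 0%N).
    rewrite -(ERWD_start erwd) /=; congr (P _); apply/seteqP; split => t /=.
      by rewrite -e0 => -[].
    by rewrite -e0 => ->.
  apply/eqP; rewrite eq_le measure_ge0 andbT.
  have m0 := ERWD_measurable erwd 0%N 0.
  rewrite -[leRHS](_ : P (~` (omega 0%N @^-1` [set 0])) = 0%E); last first.
    rewrite probability_setC// [X in (1 - X)%E](_ : _ = 1%E) ?subee//.
    exact: (ERWD_start erwd).
  apply: le_measure; rewrite ?inE//; first by have := mh 0%N; rewrite hist.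
    exact: measurableC.
  by move=> t /= [->] e; rewrite e eqxx in e0.
have -> : Ex p n.+1 (fun w => (trace w == rtrace eta n.+1)%:R) =
    Ex p n (fun w => (trace w == rtrace eta n)%:R) *
    step_prob beta mu eta n (eta n.+1 - eta n).
  rewrite Ex_rcons -ExZr; apply: eq_Ex => u _ /=.
  have [e|ne] := eqVneq (trace u) (rtrace eta n); last first.
    rewrite mul0r big1// => a _.
    by rewrite trace_rcons eqseq_cons (negbTE ne) andbF mulr0.
  have pu : pos u = eta n by rewrite /pos e head_rtrace.
  have fu : ~~ fresh u = visited_before eta n.
    by rewrite /fresh pu e negbK mem_behead_rtrace.
  rewrite mul1r /step_prob -step_weightE -fu; apply: eq_bigr => a _.
  rewrite trace_rcons eqseq_cons e eqxx andbT pu; congr (_ * (nat_of_bool _)%:R).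
  by rewrite -subr_eq0 -[in RHS]subr_eq0 opprB addrA [eta n + _]addrC.
have hS : history omega eta n.+1 =
    history omega eta n `&` [set t | omega n.+1 t = eta n + (eta n.+1 - eta n)].
  rewrite addrC subrK; apply/seteqP; split => t /=.
    by move=> h; split=> [k kn|]; apply: h => //; exact: leqW.
  by move=> [h hn] k; rewrite leq_eqVlt => /orP[/eqP->//|]; exact: h.
have mS : measurable [set t | omega n.+1 t = eta n + (eta n.+1 - eta n)].
  exact: (ERWD_measurable erwd).
(* On a null history the conditional probability is not prescribed; both sides then vanish by
   monotonicity. *)
have [h0|h0] := eqVneq (P (history omega eta n)) 0%E.
  have := IHn; rewrite h0 => -[<-]; rewrite mul0r.
  apply/eqP; rewrite eq_le measure_ge0 andbT -[leRHS]h0 hS.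
  by apply: le_measure; rewrite ?inE//; exact: measurableI.
have := ERWD_step erwd (eta n.+1 - eta n) h0; rewrite /cond_prob => <-.
rewrite -hS IHn /= mulrCA divff ?mulr1.
  by rewrite fineK// fin_num_measure.
by apply: contra_neq h0 => e; rewrite IHn e.
Qed.

Lemma rtrace_law n h : P [set t | rtrace (omega^~ t) n = h] =
  (Ex p n (fun w => (trace w == h)%:R))%:E.
Proof.
have [sh|sh] := eqVneq (size h) n.+1; last first.
  rewrite (_ : [set _ | _] = set0); last first.
    by apply/seteqP; split => t //= e; rewrite -e size_rtrace eqxx in sh.
  rewrite measure0 (eq_Ex _ (g := fun=> 0)) ?Ex0// => w sw.
  by case: eqP => // e; rewrite -e size_trace sw eqxx in sh.
have [eta he] : exists eta, h = rtrace eta n.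
  elim: n h sh => [|n IHn] [//|x h] [sh].
    by exists (fun=> x); case: h sh.
  have [eta he] := IHn _ sh; exists (fun k => if k == n.+1 then x else eta k).
  rewrite /= eqxx he; congr (_ :: _); apply/rtrace_inj => k kn.
  by rewrite ltn_eqF.
rewrite he -history_law; congr (P _); apply/seteqP; split => t /=.
  by move/rtrace_inj.
by move=> hk; apply/rtrace_inj.
Qed.

Lemma rtrace_mem_law n (L : seq (seq V)) : uniq L ->
  P [set t | rtrace (omega^~ t) n \in L] =
  (Ex p n (fun w => (trace w \in L)%:R))%:E.
Proof.
elim: L => [|h L IHL] /=.
  by rewrite (_ : [set _ | _] = set0) ?measure0 ?Ex0//; apply/seteqP; split.
move=> /andP[hL uL].
rewrite (_ : [set _ | _] = [set t | rtrace (omega^~ t) n = h] `|`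
    [set t | rtrace (omega^~ t) n \in L]); last first.
  apply/seteqP; split => t /=; rewrite inE.
    by move=> /orP[/eqP|]; [left|right].
  by move=> [->|->]; rewrite ?eqxx ?orbT.
transitivity (P [set t | rtrace (omega^~ t) n = h] +
    P [set t | rtrace (omega^~ t) n \in L])%E.
  apply: measureU; first exact: measurable_rtrace.
    exact: (measurable_path n (fun s => s \in L)).
  by apply/seteqP; split => t //= -[->]; rewrite (negbTE hL).
rewrite rtrace_law IHL// -EFinD -ExD; congr (_%:E); apply: eq_Ex => w _.
rewrite inE; case: eqP => [->|_]; first by rewrite (negbTE hL) addr0.
by rewrite add0r.
Qed.

(** Words of length [n] have finitely many traces, listed in [L]. The path lies in [L] almost
    surely, which reduces the event to a finite list. *)
Lemma path_law_le n (Q : pred (seq V)) : (P [set t | Q (rtrace (omega^~ t) n)] <=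
  (Ex p n (fun w => (Q (trace w))%:R))%:E)%E.
Proof.
have p_ge0 := weight_ge0; have p_sum1 := weight_sum1 (d := d) beta mu.
pose L := undup [seq trace (val w) | w : n.-tuple letter].
have memL w : size w = n -> trace w \in L.
  move=> sw; rewrite mem_undup; apply/mapP.
  by exists (Tuple (introT eqP sw)); rewrite ?mem_enum.
have PL : P [set t | rtrace (omega^~ t) n \in L] = 1%E.
  rewrite rtrace_mem_law ?undup_uniq// -[in RHS](Ex_cst p_sum1 n 1).
  by congr (_%:E); apply: eq_Ex => w /memL ->.
have mL : measurable [set t | rtrace (omega^~ t) n \in L].
  exact: (measurable_path n (fun s => s \in L)).
have mQ : measurable [set t | Q (rtrace (omega^~ t) n)].
  exact: (measurable_path n (fun s => Q s)).
pose LQ := [seq h <- L | Q h].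
have mLQ : measurable [set t | rtrace (omega^~ t) n \in LQ].
  exact: (measurable_path n (fun s => s \in LQ)).
apply: (@le_trans _ _ (P ([set t | rtrace (omega^~ t) n \in LQ] `|`
    ~` [set t | rtrace (omega^~ t) n \in L]))).
  apply: le_measure; rewrite ?inE//.
    by apply: measurableU => //; exact: measurableC.
  move=> t /= Qt; have [tL|/negP tL] := boolP (rtrace (omega^~ t) n \in L).
    by left; rewrite mem_filter Qt.
  by right.
apply: (@le_trans _ _ (P [set t | rtrace (omega^~ t) n \in LQ] +
    P (~` [set t | rtrace (omega^~ t) n \in L]))%E).
  by apply: measureU2 => //; exact: measurableC.
rewrite probability_setC// PL subee// adde0 rtrace_mem_law; last first.
  by rewrite filter_uniq// undup_uniq.
rewrite lee_fin; apply: le_Ex => // w sw.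
by rewrite mem_filter; case: (Q _) => //=; case: (_ \in _).
Qed.

End PathLaw.

(** * Measurability of convergence to a positive limit *)

Section PositiveLimit.
Context {R : realType} {disp : measure_display} {T : measurableType disp}.

(** A positive limit exists exactly when the sequence is Cauchy and eventually at least some
    [1 / (k + 1)], a countable combination of events on pairs of indices. *)
Lemma measurable_pos_limit (f : nat -> T -> R) :
    (forall m n (Q : R -> R -> Prop), measurable [set t | Q (f m t) (f n t)]) ->
  measurable [set t | exists l : R, 0 < l /\ (fun n => f n t) @ \oo --> l].
Proof.
move=> mf; rewrite (_ : [set _ | _] =
  (\bigcap_k \bigcup_N \bigcap_(m in [set m | N <= m]%N)
     \bigcap_(n in [set n | N <= n]%N) [set t | `|f m t - f n t| <= k.+1%:R^-1]) `&`
  (\bigcup_k \bigcup_N \bigcap_(n in [set n | N <= n]%N)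
     [set t | k.+1%:R^-1 <= f n t])).
  have ne N : [set m | N <= m]%N !=set0 by exists N => /=.
  apply: measurableI.
    apply: bigcap_measurable => [|k _]; first by exists 0%N.
    apply: bigcup_measurable => N _; apply: bigcap_measurable => // m _.
    apply: bigcap_measurable => // n _.
    exact: (mf m n (fun x y => `|x - y| <= k.+1%:R^-1)).
  apply: bigcup_measurable => k _; apply: bigcup_measurable => N _.
  apply: bigcap_measurable => // n _.
  exact: (mf n n (fun x y => k.+1%:R^-1 <= x)).
have small (e : R) : 0 < e -> exists k : nat, k.+1%:R^-1 <= e.
  move=> e0; exists (Num.truncn e^-1); rewrite -[leRHS]invrK lef_pV2 ?posrE ?invr_gt0 ?ltr0n//.
  by rewrite ltW// truncnS_gt.
apply/seteqP; split => t /=.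
  move=> [l [l0 fl]]; split.
    move=> k _; have e0 : 0 < k.+1%:R^-1 / 2 :> R by rewrite divr_gt0// invr_gt0 ltr0n.
    have [N _ hN] : \forall n \near \oo, `|l - f n t| <= k.+1%:R^-1 / 2.
      by move/cvgrPdist_le : fl; apply.
    exists N => // m /= Nm n /= Nn; have := hN _ Nm; have := hN _ Nn => /= h1 h2.
    have -> : f m t - f n t = - (l - f m t) + (l - f n t) by ring.
    apply: le_trans (ler_normD _ _) _; rewrite normrN.
    by move: h1 h2; move: `|_| `|_| (_^-1) => x y z; lra.
  have l2 : 0 < l / 2 by rewrite divr_gt0.
  have [k kl] := small _ l2.
  have [N _ hN] : \forall n \near \oo, `|l - f n t| <= l / 2.
    by move/cvgrPdist_le : fl; apply.
  exists k => //; exists N => // n /= /hN /=; rewrite ler_norml => /andP[_ h].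
  by apply: le_trans kl _; lra.
move=> [fc [k _ [N _ fk]]].
have : cvgn (fun n => f n t).
  apply/cauchy_cvgP/cauchy_exP => e e0.
  have e2 : 0 < e / 2 by rewrite divr_gt0.
  have [i ie] := small _ e2.
  have [N' _ hN'] := fc i I.
  exists (f N' t); exists N' => //= n /= N'n; rewrite -ball_normE /=.
  apply: le_lt_trans (hN' N' _ n N'n) _ => /=; first exact: leqnn.
  by apply: le_lt_trans ie _; lra.
move=> cf; exists (limn (fun n => f n t)); split=> //.
have k0 : 0 < k.+1%:R^-1 :> R by rewrite invr_gt0 ltr0n.
by apply: lt_le_trans k0 _; apply: limr_ge => //; exists N.
Qed.

End PositiveLimit.

(** * Law of large numbers and positivity of the speed *)

Section Speed.
Context {R : realType} {d : nat} (beta mu : R).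
Local Notation letter := (@letter d).
Local Notation V := 'rV[int]_d.+1.
Local Notation p := (@weight R d beta mu).
Hypothesis d8 : (8 <= d)%N.
Hypothesis beta01 : 0 <= beta <= 1.
Hypothesis mu01 : 0 <= mu <= 1.

Definition speed_approx (K : nat) : R := xmean p (K ^ 4) / (K ^ 4)%:R.

Lemma speed_estimates : exists2 D : R, 0 <= D & forall K, (0 < K)%N ->
  (forall N, (xmean p (N * K ^ 4) - N%:R * xmean p (K ^ 4)) ^+ 2 <=
     N%:R ^+ 2 * (D * K%:R ^+ 7)) /\
  Ex p (K * K ^ 4) (fun w => ((xpos w)%:~R - K%:R * xmean p (K ^ 4)) ^+ 2) <=
  (2 + 2 * D) * K%:R ^+ 9.
Proof.
have p_ge0 := weight_ge0 (d := d) beta01 mu01.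
have p_sum1 := weight_sum1 (d := d) beta mu.
have C0 : 0 <= (@heat_cst R d) by rewrite /heat_cst !mulr_ge0// exprn_ge0.
pose M := Num.truncn (8 * (@heat_cst R d)).
have CM : 8 * (@heat_cst R d) <= M.+1%:R by rewrite ltW// truncnS_gt.
(* An axis other than the first gives a letter of weight [1 / (4 (d + 1))], positive even when
   [beta] or [mu] is 1. *)
pose e : letter := (ord_max, true, true).
have e0 : e.1.1 != ord0 by rewrite /e /= -val_eqE /= -lt0n; lia.
have pe : 0 < p e by rewrite /weight (negbTE e0) !divr_gt0// ltr0n.
have heat := heat_kernel p_ge0 (ltnW (ltnW d8)).
exists (defect_cst p (@heat_cst R d) e M) => [|K K0].
  by rewrite /defect_cst !addr_ge0// ?mulr_ge0// invr_ge0 exprn_ge0.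
split=> [N|].
  exact: (xmean_blocks p_ge0 p_sum1 C0 heat e0 pe CM).
exact: (xpos_block_variance p_ge0 p_sum1 C0 heat e0 pe CM).
Qed.

(** Both [K] and [L] are compared with [L * K]: a word of length [(L K)^4] consists of [L^4] blocks
    of length [K^4], and symmetrically. *)
Lemma speed_approx_cauchy (D : R) : 0 <= D ->
    (forall K, (0 < K)%N -> forall N,
      (xmean p (N * K ^ 4) - N%:R * xmean p (K ^ 4)) ^+ 2 <=
      N%:R ^+ 2 * (D * K%:R ^+ 7)) ->
  forall K L, (0 < K)%N -> (0 < L)%N ->
  (speed_approx K - speed_approx L) ^+ 2 <= 2 * D / K%:R + 2 * D / L%:R.
Proof.
move=> D0 H.
have half K L : (0 < K)%N -> (0 < L)%N ->
    (speed_approx (L * K) - speed_approx K) ^+ 2 <= D / K%:R.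
  move=> K0 L0; have := H K K0 (L ^ 4)%N; rewrite /speed_approx expnMn.
  have K0R : 0 < K%:R :> R by rewrite ltr0n.
  have L0R : 0 < L%:R :> R by rewrite ltr0n.
  set x := xmean _ _; set y := xmean _ _; rewrite natrM !natrX => h.
  have -> : x / (L%:R ^+ 4 * K%:R ^+ 4) - y / K%:R ^+ 4 =
      (x - L%:R ^+ 4 * y) / (L%:R ^+ 4 * K%:R ^+ 4).
    by field; rewrite !gt_eqF.
  rewrite expr_div_n ler_pdivrMr ?exprn_gt0 ?mulr_gt0 ?exprn_gt0//.
  apply: le_trans h _; apply: eq_ler; field; by rewrite gt_eqF.
move=> K L K0 L0; have h1 := half K L K0 L0; have h2 := half L K L0 K0.
rewrite mulnC in h2.
move: h1 h2; set a := speed_approx K; set b := speed_approx L; set c := speed_approx _.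
rewrite -!mulrA; move: (D / _) (D / _) => u v h1 h2.
have := sqr_ge0 ((c - a) + (c - b)); nra.
Qed.

Context {disp : measure_display} {T : measurableType disp} (P : probability T R)
  (omega : nat -> T -> 'rV[int]_d.+1).
Hypothesis erwd : is_ERWD beta mu P omega.

Let x (n : nat) (t : T) : int := omega n t ord0 ord0.

Lemma nth_rtrace (eta : nat -> V) n m : (m <= n)%N ->
  nth 0 (rtrace eta n) (n - m) = eta m.
Proof.
elim: n => [|n IHn]; first by rewrite leqn0 => /eqP->.
rewrite leq_eqVlt => /orP[/eqP->|mn]; first by rewrite subnn.
by rewrite subSn//=; exact: IHn.
Qed.

Lemma measurable_xx m n (Q : int -> int -> Prop) :
  measurable [set t | Q (x m t) (x n t)].
Proof.
have := measurable_path erwd (maxn m n) (fun h =>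
  Q (nth 0 h (maxn m n - m) ord0 ord0) (nth 0 h (maxn m n - n) ord0 ord0)).
by under eq_set do rewrite !nth_rtrace ?leq_maxl ?leq_maxr//.
Qed.

Lemma Ex0_pred n (Q : pred (seq letter)) : (forall w, size w = n -> ~~ Q w) ->
  Ex p n (fun w => (Q w)%:R) = 0.
Proof.
by move=> nQ; rewrite (eq_Ex _ (g := fun=> 0)) ?Ex0// => w /nQ /negbTE->.
Qed.

(** Only the law of [omega] is prescribed, so bounds valid for every word hold for the process off a
    null set. *)
Lemma x_norm_negligible n : P.-negligible [set t | ~~ (`|x n t| <= n%:Z)].
Proof.
apply/negligibleP; first exact: (measurable_xx n n (fun u _ => ~~ (`|u| <= n%:Z))).
apply/eqP; rewrite eq_le measure_ge0 andbT.
have := path_law_le beta01 mu01 erwd n (fun h => ~~ (`|head 0 h ord0 ord0| <= n%:Z)).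
rewrite Ex0_pred; last by move=> w sw; rewrite negbK -sw; exact: xpos_le.
by under eq_set do rewrite head_rtrace.
Qed.

Lemma x_step_negligible n : P.-negligible [set t | ~~ (`|x n.+1 t - x n t| <= 1)].
Proof.
apply/negligibleP; first exact: (measurable_xx n.+1 n (fun u v => ~~ (`|u - v| <= 1))).
apply/eqP; rewrite eq_le measure_ge0 andbT.
have := path_law_le beta01 mu01 erwd n.+1
  (fun h => ~~ (`|head 0 h ord0 ord0 - head 0 (behead h) ord0 ord0| <= 1)).
rewrite Ex0_pred; last first.
  move=> w; case/lastP: w => // w a _; rewrite negbK trace_rcons /=.
  have := xpos_cat_le w [:: a]; rewrite cats1.
  by rewrite /xpos [pos (rcons _ _)]/pos trace_rcons.
by under eq_set do rewrite /= head_rtrace.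
Qed.

Lemma erwd_speed : 11 * mu < 16 * beta ->
  P [set t | exists l : R, 0 < l /\
    (fun n => (x n t)%:~R / n%:R : R) @ \oo --> l] = 1%E.
Proof.
move=> hbeta; have [D D0 HD] := speed_estimates.
pose a j := speed_approx (j.+1 ^ 4).
have [l al] : exists l : R, a @ \oo --> l.
  apply: (cvg_cauchy_rate (D := 2 * D)) => [|i j]; first by rewrite mulr_ge0.
  apply: le_trans (speed_approx_cauchy D0 (fun K K0 => (HD K K0).1) _ _) _;
    rewrite ?expn_gt0//.
  have le4 k : 2 * D / (k.+1 ^ 4)%:R <= 2 * D / k.+1%:R.
    rewrite ler_wpM2l ?mulr_ge0// lef_pV2 ?posrE ?ltr0n ?expn_gt0// ler_nat.
    by rewrite -{1}[k.+1]expn1 leq_pexp2l.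
  exact: lerD.
pose v := (16 * beta - 11 * mu) / (27 * d.+1%:R).
have v0 : 0 < v by rewrite divr_gt0 ?subr_gt0// mulr_gt0// ltr0n.
have l0 : 0 < l.
  apply: lt_le_trans v0 _; rewrite -(cvg_lim _ al)//.
  apply: limr_ge; first by apply/cvg_ex; exists l.
  apply: nearW => j; rewrite /a /speed_approx ler_pdivlMr ?ltr0n ?expn_gt0//.
  rewrite mulrC; apply: xmean_ge => //; first exact: weight_ge0.
    by case/andP: beta01.
  by case/andP: mu01.
(* With [K = (j + 1)^4] and length [K^5], the normalized variance is of order [1 / K = (j + 1)^-4];
   Chebyshev's inequality at threshold [1 / (j + 1)] leaves the summable [(j + 1)^-2]. *)
pose n j := (j.+1 ^ 20)%N.
pose A j := [set t | j.+1%:R^-1 < `|(x (n j) t)%:~R / (n j)%:R - a j|].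
have mA j : measurable (A j).
  exact: (measurable_xx _ (n j) (fun u _ => j.+1%:R^-1 < `|u%:~R / (n j)%:R - a j|)).
have PA j : (P (A j) <= ((2 + 2 * D) / j.+1%:R ^+ 2)%:E)%E.
  have := path_law_le beta01 mu01 erwd (n j) (fun h =>
    j.+1%:R^-1 < `|(head 0 h ord0 ord0)%:~R / (n j)%:R - a j|).
  under eq_set do rewrite head_rtrace.
  move=> /le_trans; apply; rewrite lee_fin.
  set K := (j.+1 ^ 4)%N; have K0 : (0 < K)%N by rewrite expn_gt0.
  have nK : n j = (K * K ^ 4)%N by rewrite /n -expnS -expnM.
  have j0 : 0 < j.+1%:R :> R by rewrite ltr0n.
  have K0R : 0 < K%:R :> R by rewrite ltr0n.
  have Kj : K%:R = j.+1%:R ^+ 4 :> R by rewrite natrX.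
  have n0 : 0 < (n j)%:R :> R by rewrite ltr0n expn_gt0.
  have c0 : 0 < ((n j)%:R / j.+1%:R) ^+ 2 :> R by rewrite exprn_gt0// divr_gt0.
  have := Ex_markov (Q := fun w => j.+1%:R^-1 < `|(xpos w)%:~R / (n j)%:R - a j|)
    (weight_ge0 beta01 mu01) c0 _ _ (HD K K0).2.
  rewrite -nK => h; apply: (le_trans (h _ _)).
  - by move=> w _; exact: sqr_ge0.
  - move=> w _ hw.
    have -> : (xpos w)%:~R - K%:R * xmean p (K ^ 4) =
        (n j)%:R * ((xpos w)%:~R / (n j)%:R - a j).
      rewrite /a /speed_approx -/K nK natrM natrX; field; by rewrite gt_eqF.
    rewrite !exprMn ler_wpM2l ?exprn_ge0 ?(ltW n0)//.
    rewrite -[leRHS]ger0_norm ?sqr_ge0// normrX lerXn2r ?nnegrE ?invr_ge0//.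
    exact: ltW.
  - apply: eq_ler; rewrite nK natrM natrX Kj; field.
    by rewrite gt_eqF.
have sumA : (\sum_(j <oo) P (A j) < +oo)%E.
  apply: (@le_lt_trans _ _ ((2 + 2 * D) * 2)%:E); last exact: ltry.
  apply: lime_le; first by apply: is_cvg_nneseries => k _ _; exact: measure_ge0.
  apply: nearW => N; apply: (@le_trans _ _ (\sum_(0 <= j < N)
      ((2 + 2 * D) * (2 / (j.+1%:R * j.+2%:R)))%:E)%E).
    apply: lee_sum => j _; apply: le_trans (PA j) _; rewrite lee_fin.
    rewrite ler_wpM2l ?addr_ge0 ?mulr_ge0//.
    rewrite ler_pdivlMr ?mulr_gt0 ?ltr0n// ler_pdivrMl ?exprn_gt0 ?ltr0n//.
    by rewrite -natrM -natrX -natrM ler_nat; nia.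
  rewrite sumEFin lee_fin -mulr_sumr ler_wpM2l ?addr_ge0 ?mulr_ge0//.
  rewrite -[leRHS](_ : 2 / 1%:R = 2); last by rewrite divr1.
  apply: (sum_telescope_le (F := fun k => 2 / k.+1%:R)) => k; first by rewrite divr_ge0.
  have k0 : 0 <= k%:R :> R by [].
  by rewrite -[k.+2%:R]natr1 -[k.+1%:R]natr1; field; rewrite !lt0r_neq0//; lra.
have mE : measurable [set t | exists l : R, 0 < l /\
    (fun n => (x n t)%:~R / n%:R : R) @ \oo --> l].
  apply: measurable_pos_limit => i j Q.
  exact: (measurable_xx i j (fun u w => Q (u%:~R / i%:R) (w%:~R / j%:R))).
have negl : P.-negligible (~` [set t | exists l : R, 0 < l /\
    (fun n => (x n t)%:~R / n%:R : R) @ \oo --> l]).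
  have nA : P.-negligible (lim_sup_set A).
    apply/negligibleP; last exact: lim_sup_set_cvg0.
    apply: bigcap_measurable => [|i _]; first by exists 0%N.
    by apply: bigcup_measurable => i' _; exact: mA.
  (* Off three null sets the path has steps at most 1, stays within distance [n] at time [n] and
     lies in finitely many [A j], so interpolation applies. *)
  apply: negligibleS (negligibleU (negligibleU
    (negligible_bigcup x_norm_negligible) (negligible_bigcup x_step_negligible)) nA).
  move=> t; apply: contra_notP => /not_orP[/not_orP[xn xs] xA] /=.
  exists l; split=> //.
  apply: (cvg_interpolate (k := 20) (a := a) (x := fun n => (x n t)%:~R)) => //.
  - move=> i; rewrite -rmorphB /= -intr_norm -[1]/(1%:~R) ler_int.
    by apply: contra_notT xs => h; exists i.
  - move=> i; rewrite -intr_norm -[i%:R]/(i%:~R) ler_int.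
    by apply: contra_notT xn => h; exists i.
  - have [i hi] : exists i, forall j, (i <= j)%N -> ~ A j t.
      apply: contrapT => /forallNP h; apply: xA => i _.
      apply: contrapT => hi; apply: (h i) => j ij Aj; apply: hi.
      by exists j.
    by exists i => // j /= /hi /negP; rewrite -leNgt.
rewrite -[X in P X = _]setCK probability_setC; last exact: measurableC.
have -> := (negligibleP P (measurableC mE)).1 negl.
by rewrite sube0.
Qed.

End Speed.

Theorem lemma1p4 (R : realType) (d : nat) (hd : (9 <= d)%N)
    (mu : R) (hmu : 0 < mu <= 1) :
  exists bstar : R, 0 < bstar < 1 /\
    forall beta : R, 0 <= beta <= 1 -> bstar < beta ->
    forall (disp : measure_display) (T : measurableType disp)
      (P : probability T R) (omega : nat -> T -> 'rV[int]_d),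
    is_ERWD beta mu P omega ->
    P [set t | exists l : R, 0 < l /\
         (fun n : nat => (coord1 (omega n t))%:~R / n%:R : R) @ \oo --> l]
      = 1%E.
Proof.
have [mu0 mu1] := andP hmu.
(* Since [mu <= 1], [11 / 16 < beta] gives [11 * mu < 16 * beta]. *)
exists (11 / 16); split=> [|beta beta01 hbeta disp T P omega]; first lra.
case: d hd omega => [//|d] d8 omega erwd.
by apply: (erwd_speed d8 beta01 _ erwd); lra.
Qed.
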